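(* Let $X$ be a real Banach space and $G$ a topological group satisfying condition $(G_0)$ stated in the context. Let $I=\Phi+\Psi:X\to(-\infty,\infty]$ with $\Phi\in C^1(X,\mathbb{R})$ and $\Psi:X\to(-\infty,\infty]$ convex, lower semicontinuous and $\Psi\not\equiv\infty$. Suppose that $I$ satisfies the Palais-Smale condition, $\Phi$ and $\Psi$ are $G$-invariant functionals, $I(0)=0$, and that $\gamma_G(A)<\infty$ for every compact set $A\in\Sigma$. For $j\in\mathbb{N}$ set $$c_j:=\inf_{A\in\Gamma_j}\ \sup_{u\in A}I(u),$$ and assume: i) $-\infty<c_j$ for every $j\in\mathbb{N}$; ii) given $j\in\mathbb{N}$, there exists a nonempty compact set $A\in\Sigma$ such that $\gamma_G(A)\ge j$ and $\sup_{u\in A}I(u)<0$. Then the numbers $c_j$ are negative critical values of $I$ with $\lim_{j\to\infty} c_j=0$.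
   Context: A point $u\in X$ is a critical point of $I=\Phi+\Psi$ if $I(u)<\infty$ and $\langle\Phi'(u),v-u\rangle+\Psi(v)-\Psi(u)\ge 0$ for all $v\in X$; a critical value is a number $I(u)$ with $u$ a critical point. A Palais-Smale sequence for $I$ at level $c$ is a sequence $(u_n)$ with $I(u_n)\to c$ and, for some $\varepsilon_n\to0^+$, $\langle\Phi'(u_n),v-u_n\rangle+\Psi(v)-\Psi(u_n)\ge-\varepsilon_n\|v-u_n\|$ for all $v\in X$. $I$ satisfies the Palais-Smale condition if, for every level $c\in\mathbb{R}$, each Palais-Smale sequence at level $c$ has a convergent subsequence. An action of $G$ on $X$ is a continuous map $G\times X\to X$, $(g,v)\mapsto gv$, with $ev=v$, $(gh)v=g(hv)$, and $v\mapsto gv$ linear for each $g$; it is isometric if $\|gv\|=\|v\|$ for all $g,v$. A set $A\subset X$ is $G$-invariant if $gA=A$ for every $g\in G$; a map $\gamma$ on a $G$-invariant set is equivariant if $\gamma(gx)=g\gamma(x)$; a functional $\varphi$ is $G$-invariant if $\varphi(gx)=\varphi(x)$ for all $x,g$. Admissibility: let $V$ be a finite dimensional vector space on which the compact group $G$ acts, and let $G$ act diagonally on $V^k$, $g(v_1,\dots,v_k)=(gv_1,\dots,gv_k)$. The action of $G$ on $V$ is admissible if for each $k\ge2$, each bounded $G$-invariant open set $U\subset V^k$ with $0\in U$, and each continuous equivariant map $\gamma:\partial U\to V^{k-1}$, there is $u\in\partial U$ with $\gamma(u)=0$. Condition $(G_0)$: $G$ is a compact group that acts isometrically on $X=\overline{\bigoplus_{j\in\mathbb{N}}X_j}$,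 where every $X_j$ is a $G$-invariant subspace of $X$ such that $X_j\cong V$, with $V$ a finite dimensional vector space for which the action of $G$ is admissible. $G$-index: $\Sigma$ is the class of subsets of $X\setminus\{0\}$ that are $G$-invariant and closed in $X$. For $A\in\Sigma\setminus\{\emptyset\}$, $\gamma_G(A)$ is the smallest integer $k\ge1$ for which there is a continuous equivariant map $\phi:A\to V^k\setminus\{0\}$ ($V$ the space in $(G_0)$), and $\gamma_G(A):=\infty$ if no such integer exists; $\gamma_G(\emptyset):=0$. The Hausdorff metric on nonempty closed bounded subsets of $X$ is $d_H(A,B):=\max\{\sup_{x\in A}d(x,B),\sup_{y\in B}d(y,A)\}$. $\mathcal{D}_G$ is the collection of nonempty compact $G$-invariant subsets of $X$, with metric $d_H$, and $\Gamma_j$ is the closure in $(\mathcal D_G,d_H)$ of $\{A\in\mathcal{D}_G:0\notin A,\ \gamma_G(A)\ge j\}$. *)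

(* Defs.v *)
From HB Require Import structures.
From mathcomp Require Import all_boot all_order all_algebra.
From mathcomp Require Import all_classical all_reals all_analysis.

Set Implicit Arguments.
Unset Strict Implicit.
Unset Printing Implicit Defensive.

Import Order.TTheory GRing.Theory Num.Theory.
Import numFieldNormedType.Exports.

Local Open Scope classical_set_scope.
Local Open Scope ring_scope.

HB.mixin Record isTopologicalGroup G of Topological G & Group G := {
  mulg_continuous : continuous (fun gh : G * G => (gh.1 * gh.2)%g);
  invg_continuous : continuous (fun g : G => (g^-1)%g)
}.

#[short(type="topologicalGroupType")]
HB.structure Definition TopologicalGroup :=
  {G of Topological G & Group G & isTopologicalGroup G}.

Section Actions.
Context {R : realType} {G : topologicalGroupType}.

Record is_action (X : normedModType R) (act : G -> X -> X) : Prop := {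
  act_continuous : continuous (fun gv : G * X => act gv.1 gv.2);
  act1 : forall v, act 1%g v = v;
  actM : forall g h v, act (g * h)%g v = act g (act h v);
  act_linear : forall g, linear (act g)
}.

Definition is_isometric (X : normedModType R) (act : G -> X -> X) : Prop :=
  forall g v, `|act g v| = `|v|.

Definition invariant_set (T : Type) (act : G -> T -> T) (A : set T) : Prop :=
  forall g, act g @` A = A.

Definition invariant_fun (T S : Type) (act : G -> T -> T) (f : T -> S) : Prop :=
  forall g x, f (act g x) = f x.

Definition equivariant_on (S T : Type) (actS : G -> S -> S)
    (actT : G -> T -> T) (A : set S) (f : S -> T) : Prop :=
  forall g x, A x -> f (actS g x) = actT g (f x).

(* V^k is 'rV[V]_k; its canonical topology is the product topology. *)
Definition diag_act (V : normedModType R) (act : G -> V -> V) (k : nat)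
    (g : G) (v : 'rV[V]_k) : 'rV[V]_k := map_mx (act g) v.

Definition boundary (T : topologicalType) (U : set T) : set T :=
  closure U `\` interior U.

Definition bounded_pow (V : normedModType R) (k : nat)
    (U : set 'rV[V]_k) : Prop :=
  exists M : R, forall u, U u -> forall i, `|u 0 i| <= M.

Definition admissible (V : normedModType R) (act : G -> V -> V) : Prop :=
  forall k : nat, (2 <= k)%N ->
  forall U : set 'rV[V]_k,
    bounded_pow U -> invariant_set (diag_act act (k := k)) U -> open U -> U 0 ->
  forall gamma : 'rV[V]_k -> 'rV[V]_k.-1,
    {within boundary U, continuous gamma} ->
    equivariant_on (diag_act act (k := k)) (diag_act act (k := k.-1))
      (boundary U) gamma ->
  exists2 u, boundary U u & gamma u = 0.

(* The vector topology of a finite dimensional space is unique, so that V can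
   be given as a normed module. *)
Definition finite_dimensional (V : normedModType R) : Prop :=
  exists (n : nat) (b : 'I_n -> V),
    forall v, exists c : 'I_n -> R, v = \sum_(i < n) c i *: b i.

Definition linear_subspace (X : normedModType R) (W : set X) : Prop :=
  W 0 /\ forall (a : R) u v, W u -> W v -> W (a *: u + v).

Definition finite_sums (X : normedModType R) (W : nat -> set X) : set X :=
  [set v | exists n (x : nat -> X),
    (forall j, W j (x j)) /\ v = \sum_(j < n) x j].

Definition independent (X : normedModType R) (W : nat -> set X) : Prop :=
  forall n (x : nat -> X), (forall j, W j (x j)) ->
    \sum_(j < n) x j = 0 -> forall j, (j < n)%N -> x j = 0.

(* X_j and V isomorphic as representations of G; the isomorphism is a
   homeomorphism by finite dimensionality. *)
Definition isomorphic_to_subspace (X V : normedModType R)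
    (actX : G -> X -> X) (actV : G -> V -> V) (W : set X) : Prop :=
  exists f : {linear V -> X},
    [/\ injective f, range f = W & forall g v, f (actV g v) = actX g (f v)].

Record condition_G0 (X V : normedModType R) (actX : G -> X -> X)
    (actV : G -> V -> V) (Xj : nat -> set X) : Prop := {
  G0_compact : compact [set: G];
  G0_action : is_action actX;
  G0_isometric : is_isometric actX;
  G0_subspace : forall j, linear_subspace (Xj j);
  G0_invariant : forall j, invariant_set actX (Xj j);
  G0_independent : independent Xj;
  G0_dense : closure (finite_sums Xj) = [set: X];
  G0_V_finite_dimensional : finite_dimensional V;
  G0_V_action : is_action actV;
  G0_V_admissible : admissible actV;
  G0_isomorphic : forall j, isomorphic_to_subspace actX actV (Xj j)
}.

End Actions.

Section Index.
Context {R : realType} {G : topologicalGroupType}.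
Context {X V : normedModType R} (actX : G -> X -> X) (actV : G -> V -> V).

Definition Sigma_class (A : set X) : Prop :=
  [/\ ~ A 0, invariant_set actX A & closed A].

(* The infimum of a set of integers is attained; that of set0 is +oo. *)
Definition gindex (A : set X) : \bar R :=
  if A == set0 then 0%E else
  ereal_inf [set k%:R%:E | k in [set k : nat | (1 <= k)%N /\
    exists phi : X -> 'rV[V]_k,
      [/\ {within A, continuous phi},
          forall x, A x -> phi x != 0 &
          equivariant_on actX (diag_act actV (k := k)) A phi]]].

Definition dist_to (x : X) (B : set X) : R := inf [set `|x - y| | y in B].

Definition hausdorff_dist (A B : set X) : R :=
  Num.max (sup [set dist_to x B | x in A]) (sup [set dist_to y A | y in B]).

Definition D_G (A : set X) : Prop :=
  [/\ A !=set0, compact A & invariant_set actX A].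

(* Gamma 0 = Gamma 1, as gindex is at least 1 on nonempty sets: counting indices
   from 0 or from 1 makes no difference. *)
Definition Gamma (j : nat) : set (set X) :=
  [set A | D_G A /\ forall e : R, 0 < e ->
    exists B, [/\ D_G B, ~ B 0, (j%:R%:E <= gindex B)%E
                & hausdorff_dist A B < e]].

Definition minimax (I : X -> \bar R) (j : nat) : \bar R :=
  ereal_inf [set ereal_sup [set I u | u in A] | A in Gamma j].

End Index.

Section Functionals.
Context {R : realType} {X : normedModType R}.

(* The second clause is continuity of the derivative for the dual norm. *)
Definition continuously_differentiable (Phi : X -> R) : Prop :=
  (forall u, differentiable Phi u) /\
  (forall u (e : R), 0 < e -> \forall w \near u,
     forall v, `|'d Phi w v - 'd Phi u v| <= e * `|v|).

Definition ereal_convex (Psi : X -> \bar R) : Prop :=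
  forall (t : R) (x y : X), 0 <= t <= 1 ->
    (Psi (t *: x + (1 - t) *: y)%R <= t%:E * Psi x + (1 - t)%:E * Psi y)%E.

Context (Phi : X -> R) (Psi : X -> \bar R).

Definition functional (u : X) : \bar R := ((Phi u)%:E + Psi u)%E.

Definition critical_point (u : X) : Prop :=
  (functional u < +oo)%E /\
  forall v, (0 <= ('d Phi u (v - u)%R)%:E + Psi v - Psi u)%E.

Definition critical_value (c : \bar R) : Prop :=
  exists2 u, critical_point u & functional u = c.

(* With Psi v - +oo = -oo, the inequality forces Psi (u n) to be finite. *)
Definition palais_smale_sequence (c : R) (u : nat -> X) : Prop :=
  functional (u n) @[n --> \oo] --> c%:E /\
  exists eps : nat -> R,
    [/\ forall n, 0 < eps n, eps n @[n --> \oo] --> (0 : R) &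
        forall n v, ((- (eps n * `|v - u n|))%:E <=
          ('d Phi (u n) (v - u n)%R)%:E + Psi v - Psi (u n))%E].

Definition palais_smale_condition : Prop :=
  forall (c : R) (u : nat -> X), palais_smale_sequence c u ->
    exists (s : nat -> nat) (l : X),
      {homo s : m n / (m < n)%N} /\ u (s n) @[n --> \oo] --> l.

End Functionals.

(* Main.v *)
Require Import Defs.
From HB Require Import structures.
From mathcomp Require Import all_boot all_order all_algebra.
From mathcomp Require Import all_classical all_reals all_analysis.
From mathcomp Require Import ring lra.

Import Order.TTheory GRing.Theory Num.Theory.
Import numFieldNormedType.Exports.

Local Open Scope classical_set_scope.
Local Open Scope ring_scope.

Set Implicit Arguments.
Unset Strict Implicit.
Unset Printing Implicit Defensive.

(** The idea is to run Ekeland's variational principle not on the sets of the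
class Gamma_j with the Hausdorff metric, but on the equivariant continuous maps
h from one fixed almost optimal compact set A into X, with the uniform distance
and the functional h |-> sup over h(A) of I. The index does not decrease under
equivariant maps and I(0) = 0, so that as long as sup I stays negative every
image h(A) competes for c_j; hence c_j bounds the functional from below. This
is [minimax_almost_critical]: a set A of index at least j with
sup I <= c_j + e^2 has, within distance e of it, a point whose value is within
about e of c_j and which satisfies the Palais-Smale inequality with slope 4 e.

The contradiction with Ekeland's inequality is produced by
[equivariant_deformation]: if no point of a compact invariant set at height at
least a < M is almost critical, the set can be pushed down equivariantly, at a
definite rate. The directions of descent form a closed convex set at each
point, by convexity and lower semicontinuity of Psi, and near any given point
they can be obtained by aiming at a fixed target; a partition of unity gives a
continuous choice, and averaging over G makes it equivariant
([equivariant_selection]).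

The averages are obtained without Haar measure. Given functions on G which can
be approximated uniformly through finite nets of G, replacing them by the mean
of their translates by a net contracts their oscillation by a definite factor;
iterating gives a Cauchy sequence whose limit is the invariant mean
([average_exists]). The same selection theorem, with values in V, extends
equivariant nonvanishing maps approximately from an invariant compact set to a
larger one, which gives subadditivity of the index ([admits_map_union]) and its
semicontinuity on compact sets ([admits_map_neighborhood]). The latter
identifies the sets of Gamma_j not containing 0 as the sets of index at least j.

Applying this with e -> 0, the Palais-Smale condition yields a critical point at
level c_j. For the limit, suppose that c_j increases to c < 0. The critical set
at level c is compact and invariant, so a neighbourhood of it has finite index
p. From an almost optimal set for c_(j+p) one cuts this neighbourhood out; the
remainder has index at least j by subadditivity and is almost optimal for c_j,
hence has almost critical points away from the critical set at level c, whose
limit is a critical point at level c: a contradiction. *)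

(** * Finite selections and convex combinations *)

(** A finite subcover in the form used for partitions of unity: finitely many
of the locally valid choices suffice. The covering property is applied to the
filter of finite lists ordered by inclusion, which requires no structure on
the type of choices. *)
Lemma compact_finite_selection (T : topologicalType) (I : Type) (K : set T)
    (P : T -> I -> Prop) :
  compact K -> (forall x, K x -> exists i, \forall x' \near x, P x' i) ->
  exists (n : nat) (e : 'I_n -> I), forall x, K x -> exists k, P x (e k).
Proof.
move=> /compact_near_coveringP cK HP.
pose F : set_system (seq I) :=
  [set W | exists s0, forall s, (forall i, List.In i s0 -> List.In i s) -> W s].
have FF : Filter F.
  split; first by exists [::].
  - move=> A B [s1 H1] [s2 H2]; exists (s1 ++ s2) => s Hs; split.
      by apply: H1 => i Hi; apply: Hs; apply: List.in_or_app; left.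
    by apply: H2 => i Hi; apply: Hs; apply: List.in_or_app; right.
  - by move=> A B AB [s1 H1]; exists s1 => s /H1 /AB.
have [] := cK _ F (fun s x => exists i, List.In i s /\ P x i) FF.
  move=> x /HP[i Hi].
  exists ([set x' | P x' i], [set s | List.In i s]); first split => //=.
    by exists [:: i] => s; apply; left.
  by move=> [x' s] /= [? ?]; exists i.
move=> s /(_ s (fun _ => id)) Hs.
exists (size s), (tnth (in_tuple s)) => x /Hs[i [si Pi]].
suff [k ki] : exists k, tnth (in_tuple s) k = i by exists k; rewrite ki.
elim: s si {Hs} => [//|j s IH] /= [->|/IH[k <-]].
  by exists ord0; rewrite (tnth_nth i).
by exists (lift ord0 k); rewrite !(tnth_nth j).
Qed.

Definition is_convex (R : realType) (Y : lmodType R) (C : set Y) : Prop :=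
  forall y z t, 0 <= t <= 1 -> C y -> C z -> C (t *: y + (1 - t) *: z).

(** Points of weight zero may lie outside C: this is the situation of a
partition of unity, whose functions vanish where the corresponding choice is
not admissible. *)
Lemma convex_sumP (R : realType) (Y : lmodType R) (C : set Y) :
  is_convex C ->
  forall n (w : 'I_n -> R) (y : 'I_n -> Y),
    (forall k, 0 <= w k) -> (forall k, 0 < w k -> C (y k)) ->
    0 < \sum_k w k -> C ((\sum_k w k)^-1 *: \sum_k w k *: y k).
Proof.
move=> Cc; elim=> [|n IH] w y w0 wC; first by rewrite big_ord0 ltxx.
rewrite !big_ord_recr /=.
set W := \sum_(i < n) _; set S := \sum_(i < n) _ => WS.
have : 0 <= W by apply: sumr_ge0.
have := w0 ord_max; rewrite le_eqVlt => /predU1P[w1|w1].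
  move=> _; rewrite -w1 scale0r !addr0; apply: IH => //.
  - by move=> k; exact: wC.
  - by move: WS; rewrite -w1 addr0.
rewrite le_eqVlt => /predU1P[W0|W0].
  have wz : forall k : 'I_n, w (widen_ord (leqnSn n) k) = 0.
    move=> k; apply/eqP; rewrite eq_le w0 andbT W0 /W (bigD1 k)//= lerDl.
    by apply: sumr_ge0.
  have -> : S = 0 by rewrite /S big1// => k _; rewrite wz scale0r.
  rewrite -W0 !add0r scalerA mulVf ?scale1r ?gt_eqF//; exact: wC.
pose t := W / (W + w ord_max).
have t01 : 0 <= t <= 1.
  by rewrite /t divr_ge0 ?(ltW WS) ?(ltW W0)//= ler_pdivrMr// mul1r lerDl ltW.
have := Cc _ _ _ t01 (IH _ _ (fun k => w0 _) (fun k => wC _) W0) (wC _ w1).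
congr C; rewrite scalerDr scalerA; congr (_ + _).
  by rewrite /t mulrAC divff ?mul1r ?gt_eqF.
rewrite scalerA; congr (_ *: _).
rewrite /t; apply: (mulfI (lt0r_neq0 WS)); rewrite mulrBr mulr1 mulrCA.
by rewrite divff ?gt_eqF// mulr1 mulrA divff ?gt_eqF// mul1r addrAC subrr add0r.
Qed.

(** * Sequential completeness *)

Definition seq_cauchy (R : realType) (Y : normedModType R) (u : nat -> Y) :=
  forall e : R, 0 < e -> exists n, forall m, (n <= m)%N -> `|u m - u n| <= e.

Lemma seq_cauchyW (R : realType) (Y : normedModType R) (u : nat -> Y) :
  seq_cauchy u -> forall e : R, 0 < e -> exists n,
    forall m p, (n <= m)%N -> (n <= p)%N -> `|u m - u p| <= e.
Proof.
move=> cu e e0; have [n Hn] := cu (e / 2) ltac:(by rewrite divr_gt0).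
exists n => m p /Hn um /Hn up; rewrite distrC in up.
by rewrite -(subrKA (u n)) (le_trans (ler_normD _ _))//; lra.
Qed.

Lemma cvg_seq_cauchy (R : realType) (Y : normedModType R) (u : nat -> Y) (l : Y) :
  u n @[n --> \oo] --> l -> seq_cauchy u.
Proof.
move=> /cvgrPdist_le ul e e0.
have [n _ Hn] := ul (e / 2) ltac:(by rewrite divr_gt0).
exists n => m nm; have h1 := Hn m nm; have h2 := Hn n (leqnn n).
rewrite distrC in h1.
by rewrite -(subrKA l) (le_trans (ler_normD _ _))//; move: h1 h2 => /=; lra.
Qed.

(** Completeness in the sequential form, so that the statements below apply
both to a Banach space and to a finite dimensional space, which is complete
without being given as a complete structure. *)
Definition seq_complete (R : realType) (Y : normedModType R) : Prop :=
  forall u : nat -> Y, seq_cauchy u -> exists l : Y, u n @[n --> \oo] --> l.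

Lemma cvg_norm_le (R : realType) (Y : normedModType R) (u : nat -> Y) (l y : Y)
    (r : R) :
  u n @[n --> \oo] --> l -> (\forall n \near \oo, `|u n - y| <= r) ->
  `|l - y| <= r.
Proof.
move=> ul ur.
have h : `|u n - y| @[n --> \oo] --> `|l - y|.
  by apply: cvg_norm; apply: cvgB => //; exact: cvg_cst.
rewrite -(cvg_lim _ h)//; apply: limr_le => //.
by apply/cvg_ex; exists `|l - y|.
Qed.

Lemma banach_seq_complete (R : realType) (Y : completeNormedModType R) :
  seq_complete Y.
Proof.
move=> u cu; suff : cvgn u by move=> h; exists (limn u).
apply/cauchy_cvgP/cauchy_exP => e e0.
have [n Hn] := cu (e / 2) ltac:(by rewrite divr_gt0).
exists (u n), n => // m /= /Hn um; rewrite -ball_normE /ball_ /= distrC.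
by rewrite (le_lt_trans um)// ltr_pdivrMr// ltr_pMr// ltr1n.
Qed.

Definition complete_subspace (R : realType) (V : normedModType R) (W : set V) :=
  forall u : nat -> V, (forall n, W (u n)) -> seq_cauchy u ->
  exists2 l : V, W l & u n @[n --> \oo] --> l.

(** If b is at positive distance d from W, then |t| d <= |w + t b| bounds the
coefficient along b, so that a Cauchy sequence of W + R b has Cauchy
components. If b is at distance zero it already belongs to W, as W is
complete. *)
Lemma complete_subspace_add_line (R : realType) (V : normedModType R)
    (W : set V) (b : V) :
  linear_subspace W -> complete_subspace W ->
  complete_subspace [set v | exists w (t : R), W w /\ v = w + t *: b].
Proof.
move=> [W0 WL] cW u Wu cu.
have WZ a v : W v -> W (a *: v) by move=> Wv; rewrite -[_ *: _]addr0; exact: WL.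
have WB v w : W v -> W w -> W (w - v).
  by move=> Wv Ww; rewrite addrC -scaleN1r; exact: WL.
have [Wb|nWb] := pselect (W b).
  have {}Wu n : W (u n).
    by have [w [t [Ww ->]]] := Wu n; rewrite addrC; exact: WL.
  have [l Wl ul] := cW u Wu cu.
  by exists l => //; exists l, 0; split => //; rewrite scale0r addr0.
(* Otherwise b is a limit of elements of W. *)
have [d d0 Hd] : exists2 d : R, 0 < d & forall w, W w -> d <= `|b - w|.
  apply: contrapT => H; apply: nWb.
  have /choice[w Hw] : forall n : nat, exists w, W w /\ `|b - w| < n.+1%:R^-1.
    move=> n; apply: contrapT => Hn; apply: H; exists n.+1%:R^-1 => // w Ww.
    by rewrite leNgt; apply/negP => h; apply: Hn; exists w.
  have wb : w n @[n --> \oo] --> b.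
    apply/cvgrPdist_lt => e e0.
    have [n _ Hn] := near_infty_natSinv_lt (PosNum e0).
    by exists n => // m /Hn /= me; apply: lt_trans me; exact: (Hw m).2.
  have [l Wl wl] := cW w (fun n => (Hw n).1) (cvg_seq_cauchy wb).
  by rewrite (cvg_unique _ wb wl).
have /choice[wt Hwt] : forall n, exists p : V * R, W p.1 /\ u n = p.1 + p.2 *: b.
  by move=> n; have [w [t H]] := Wu n; exists (w, t).
pose w n := (wt n).1; pose t n := (wt n).2.
have Hu n : u n = w n + t n *: b := (Hwt n).2.
have Ww n : W (w n) := (Hwt n).1.
have td m n : `|t m - t n| * d <= `|u m - u n|.
  have [->|tmn] := eqVneq (t m) (t n); first by rewrite subrr normr0 mul0r.
  have s0 : t m - t n != 0 by rewrite subr_eq0.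
  have -> : u m - u n = (t m - t n) *: (b - (t m - t n)^-1 *: (w n - w m)).
    rewrite scalerBr scalerA divff// scale1r scalerBl !Hu opprB opprD.
    by rewrite [RHS]addrC addrACA.
  by rewrite normrZ ler_wpM2l// Hd//; apply: WZ; exact: WB.
have ct : seq_cauchy (t : nat -> R^o).
  move=> e e0; have [n Hn] := cu (e * d) ltac:(by rewrite mulr_gt0).
  exists n => m /Hn h; rewrite -(ler_pM2r d0); exact: le_trans (td m n) h.
have [t0 tt0] := banach_seq_complete ct.
have tb : t n *: b @[n --> \oo] --> t0 *: b by apply: cvgZr_tmp.
have cw : seq_cauchy w.
  move=> e e0.
  have [n1 H1] := seq_cauchyW cu (e := e / 2) ltac:(by rewrite divr_gt0).
  have [n2 H2] := seq_cauchyW (cvg_seq_cauchy tb) (e := e / 2)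
    ltac:(by rewrite divr_gt0).
  exists (maxn n1 n2) => m; rewrite geq_max => /andP[m1 m2].
  have -> : w m - w (maxn n1 n2) = (u m - u (maxn n1 n2)) -
      (t m *: b - t (maxn n1 n2) *: b).
    by rewrite !Hu (opprD (w _)) addrACA addrK.
  have h1 := H1 _ _ m1 (leq_maxl n1 n2); have h2 := H2 _ _ m2 (leq_maxr n1 n2).
  by rewrite (le_trans (ler_normB _ _))//; lra.
have [l Wl wl] := cW w Ww cw.
exists (l + t0 *: b); first by exists l, t0.
by under eq_fun do rewrite Hu; exact: cvgD.
Qed.

Lemma finite_dimensional_complete (R : realType) (V : normedModType R) :
  finite_dimensional V -> seq_complete V.
Proof.
move=> [n [b Hb]] u cu.
suff H : forall n (b : 'I_n -> V), let W := [set v | exists c : 'I_n -> R,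
    v = \sum_(i < n) c i *: b i] in linear_subspace W /\ complete_subspace W.
  by have [l _ ul] := (H n b).2 u (fun k => Hb (u k)) cu; exists l.
move=> {b Hb u cu}n; elim: n => [|n IH] b /=; split.
- split; first by exists (fun=> 0); rewrite big_ord0.
  by move=> a v w [c ->] [c' ->]; exists c; rewrite !big_ord0 scaler0 addr0.
- move=> u Wu _; exists 0; first by exists (fun=> 0); rewrite big_ord0.
  have -> : u = fun=> 0 by apply/funext => k; have [c ->] := Wu k; rewrite big_ord0.
  exact: cvg_cst.
- split; first by exists (fun=> 0); rewrite big1// => i _; rewrite scale0r.
  move=> a v w [c ->] [c' ->]; exists (fun i => a * c i + c' i).
  rewrite scaler_sumr -big_split/=; apply: eq_bigr => i _.
  by rewrite scalerDl scalerA.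
- have [lW cW] := IH (fun i => b (widen_ord (leqnSn n) i)).
  have cL := @complete_subspace_add_line _ _ _ (b ord_max) lW cW.
  move=> u Wu cu; have [|l [w [t [[c wc] lE]]] ul] := cL u _ cu.
    move=> k; have [c ->] := Wu k; rewrite big_ord_recr/=.
    by eexists; exists (c ord_max); split; [exists (c \o widen_ord (leqnSn n))|].
  exists l => //; exists (fun i => if unlift ord_max i is Some j then c j else t).
  rewrite lE wc big_ord_recr/= unlift_none; congr (_ + _).
  apply: eq_bigr => i _; congr (_ *: _).
  have -> : widen_ord (leqnSn n) i = lift ord_max i.
    by apply: val_inj; rewrite /= /bump leqNgt ltn_ord.
  by rewrite liftK.
Qed.

(** * Averaging over a group *)

Section Averaging.
Context {R : realType} {Y : normedModType R} {G : groupType}.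
Implicit Types (hs : seq G) (f : G -> Y).

Definition average hs f (g : G) : Y :=
  (size hs)%:R^-1 *: \sum_(h <- hs) f (h * g)%g.

Lemma average_comp ks hs f g :
  average ks (average hs f) g =
  average [seq (h * k)%g | k <- ks, h <- hs] f g.
Proof.
rewrite /average size_allpairs natrM invfM -scalerA; congr (_ *: _).
rewrite -scaler_sumr; congr (_ *: _).
rewrite big_flatten /= big_map; apply: eq_bigr => k _; rewrite big_map.
by apply: eq_bigr => h _; rewrite mulgA.
Qed.

(** The terms of the two sums need not correspond to each other: any pairing
will do, since the bound holds for all pairs. *)
Lemma ler_dist_sum (I : Type) (s t : seq I) (F F' : I -> Y) (d : R) :
  size s = size t -> (forall i j, `|F i - F' j| <= d) ->
  `|\sum_(i <- s) F i - \sum_(i <- t) F' i| <= (size s)%:R * d.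
Proof.
move=> st Fd; elim: s t st => [|i s IH] [|j t]//=.
  by rewrite !big_nil subrr normr0 mul0r.
move=> [st].
rewrite !big_cons -addn1 natrD mulrDl mul1r opprD addrACA.
by rewrite (le_trans (ler_normD _ _))// [leRHS]addrC lerD// IH.
Qed.

Lemma average_dist hs f g y (d : R) : hs != [::] ->
  (forall h, `|f h - y| <= d) -> `|average hs f g - y| <= d.
Proof.
move=> hs0 fd.
have s0 : 0 < (size hs)%:R :> R by rewrite ltr0n lt0n size_eq0.
have -> : y = (size hs)%:R^-1 *: \sum_(h <- hs) y.
  by rewrite big_const_seq count_predT iter_addr_0 -[y *+ _]scaler_nat scalerA mulVf
    ?scale1r ?gt_eqF.
rewrite -scalerBr normrZ gtr0_norm ?invr_gt0// mulrC ler_pdivrMr// mulrC.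
exact: ler_dist_sum.
Qed.

Context {J : Type}.
Implicit Type F : J -> G -> Y.

Definition osc_le F (d : R) := forall j g g', `|F j g - F j g'| <= d.

(** Every a in G is replaced by an element of a finite list up to an error d,
uniformly in the index j and under translations on both sides. Left
translations by b are included so that the property passes to averages. *)
Definition is_net F (d : R) hs := forall a, exists2 h, h \in hs &
  forall j b g, `|F j (b * a * g)%g - F j (b * h * g)%g| <= d.

Lemma is_net_average F d hs ks : ks != [::] ->
  is_net F d hs -> is_net (fun j => average ks (F j)) d hs.
Proof.
move=> ks0 nF a; have [h hhs Hh] := nF a; exists h => // j b g.
have s0 : 0 < (size ks)%:R :> R by rewrite ltr0n lt0n size_eq0.
rewrite /average -scalerBr normrZ gtr0_norm ?invr_gt0// mulrC ler_pdivrMr//.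
rewrite -sumrB (le_trans (ler_norm_sum _ _ _))//.
have -> : d * (size ks)%:R = \sum_(k <- ks) d.
  by rewrite big_const_seq count_predT iter_addr_0 mulr_natr.
by apply: ler_sum => k _; rewrite !mulgA.
Qed.

(** Comparing the averages at g and g', one term of the first, f (h g), can be
paired with a term f (k g') of the second with k close to h g / g', at a cost
d; the remaining terms cost at most d + e each. The excess e of the
oscillation over d shrinks by the factor 1 - 1/N, where N is the length of the
net. A net for the functions is also a net for their averages
([is_net_average]), so N stays the same when this is iterated. *)
Lemma osc_le_average F (d e : R) hs : hs != [::] -> is_net F d hs ->
  osc_le F (d + e) ->
  osc_le (fun j => average hs (F j)) (d + e * (1 - (size hs)%:R^-1)).
Proof.
case: hs => // h hs _ nF oF j g g'.
have [k khs Hk] := nF (h * g * g'^-1)%g.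
rewrite /average -scalerBr normrZ gtr0_norm ?invr_gt0 ?ltr0n// mulrC.
rewrite ler_pdivrMr ?ltr0n//.
rewrite big_cons (perm_big _ (perm_to_rem khs)) big_cons opprD addrACA.
rewrite (le_trans (ler_normD _ _))//.
have := Hk j 1%g g'; rewrite !mul1g mulgVK => Hk'.
rewrite (le_trans (lerD Hk' (ler_dist_sum _ (d := d + e) _)))//.
  by rewrite size_rem.
rewrite /= -addn1 natrD mulrDl -mulrA mulrBl mulVf ?mul1r; last first.
  by rewrite -natrD addn1 pnatr_eq0.
lra.
Qed.

Lemma osc_le_small F (D : R) :
  (forall d : R, 0 < d -> exists2 hs, hs != [::] & is_net F d hs) ->
  osc_le F D -> forall d : R, 0 < d ->
  exists2 hs, hs != [::] & osc_le (fun j => average hs (F j)) d.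
Proof.
move=> nF oF d d0.
have [ks ks0 nks] := nF (d / 2) ltac:(by rewrite divr_gt0).
pose q : R := 1 - (size ks)%:R^-1.
have q1 : `|q| < 1.
  have s0 : 0 < (size ks)%:R :> R by rewrite ltr0n lt0n size_eq0.
  have s1 : 1 <= (size ks)%:R :> R by rewrite ler1n lt0n size_eq0.
  rewrite ger0_norm /q ?subr_ge0 ?invf_le1// ltrBlDr ltrDl invr_gt0//.
have H n : exists2 hs, hs != [::] &
    osc_le (fun j => average hs (F j)) (d / 2 + D * q ^+ n).
  elim: n => [|n [hs hs0 IH]].
    exists [:: 1%g] => // j g g'; rewrite /average !big_seq1 invr1 !scale1r !mul1g.
    by rewrite expr0 mulr1 (le_trans (oF _ _ _))// lerDr divr_ge0// ltW.
  exists [seq (h * k)%g | k <- ks, h <- hs].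
    by rewrite -size_eq0 size_allpairs muln_eq0 negb_or !size_eq0 ks0.
  have := osc_le_average ks0 (is_net_average hs0 nks) IH.
  by move=> h j g g'; rewrite -!average_comp exprSr mulrA; exact: h.
have : D * q ^+ n @[n --> \oo] --> (0 : R).
  by rewrite -(mulr0 D); apply: cvgMr; exact: cvg_expr.
move=> /cvgrPdist_le /(_ (d / 2)) /(_ ltac:(by rewrite divr_gt0)) [n _ Hn].
have [hs hs0 oH] := H n; exists hs => // j g g'.
rewrite (le_trans (oH _ _ _))//.
have := Hn n (leqnn n); rewrite /= sub0r normrN => /(le_trans (ler_norm _)).
lra.
Qed.

(** The mean value of each function on G, in the role of its integral for the
Haar measure. It is characterised as a uniform limit of averages of
translates, with translating elements independent of j: every identity between
the functions F j that averages and translations preserve passes to the means.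
*)
Lemma average_exists F (D : R) : seq_complete Y ->
  (forall d : R, 0 < d -> exists2 hs, hs != [::] & is_net F d hs) ->
  osc_le F D ->
  exists m : J -> Y, forall d : R, 0 < d ->
    exists2 hs, hs != [::] & forall j g, `|average hs (F j) g - m j| <= d.
Proof.
move=> cY nF oF.
pose e n : R := 2^-1 ^+ n.
have e0 n : 0 < e n by rewrite exprn_gt0// invr_gt0.
have step (p : nat * seq G) : exists hs, p.2 != [::] -> hs != [::] /\
    osc_le (fun j => average hs (average p.2 (F j))) (e p.1.+1).
  have [->|p0] := eqVneq p.2 [::]; first by exists [::].
  have := @osc_le_small (fun j => average p.2 (F j)) D _ _ (e p.1.+1) (e0 _).
  case.
  - by move=> d /nF[hs hs0 nh]; exists hs => //; exact: is_net_average.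
  - move=> j g g'; apply: average_dist => // h.
    by rewrite distrC; apply: average_dist.
  - by move=> hs hs0 oh; exists hs.
have [S HS] := choice step.
(* Each list refines the previous one by further averaging, so that later
   averages stay in the convex hull of the values of earlier ones, while the
   bound on the oscillation halves. *)
pose H := fix H n := if n is n'.+1 then
  [seq (h * k)%g | k <- S (n', H n'), h <- H n'] else S (0%N, [:: 1%g]).
have Hn0 n : H n != [::].
  elim: n => [|n IH] /=; first by have [] := HS (0%N, [:: 1%g]) isT.
  have [S0 _] := HS (n, H n) IH.
  by rewrite -size_eq0 size_allpairs muln_eq0 negb_or !size_eq0 IH S0.
have oH n j g g' : `|average (H n.+1) (F j) g - average (H n.+1) (F j) g'| <= e n.+1.
  have [S0 o] := HS (n, H n) (Hn0 n).
  by rewrite /= -!average_comp; exact: o.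
have cH n m j g g' : (n < m)%N ->
    `|average (H m) (F j) g - average (H n.+1) (F j) g'| <= e n.+1.
  elim: m g => // m IH g; rewrite ltnS leq_eqVlt => /predU1P[->|nm].
    exact: oH.
  have [S0 _] := HS (m, H m) (Hn0 m).
  by rewrite /= -average_comp; apply: average_dist => // h; exact: IH.
have ecv : e n @[n --> \oo] --> (0 : R).
  by apply: cvg_expr; rewrite gtr0_norm ?invr_gt0// invf_lt1// ltr1n.
have eS d : 0 < d -> exists n, e n.+1 <= d.
  move=> d0; have /cvgrPdist_le /(_ d d0)[n _ Hn] := ecv.
  exists n; have := Hn n.+1 (leqnSn n); rewrite /= sub0r normrN.
  exact: le_trans (ler_norm _).
have lim j : exists l : Y, average (H n) (F j) 1%g @[n --> \oo] --> l.
  apply: cY => d /eS[n en]; exists n.+1 => m nm.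
  exact: le_trans (cH _ _ _ _ _ nm) en.
have [m Hm] := choice lim.
exists m => d /eS[n en]; exists (H n.+1) => // j g.
rewrite distrC (le_trans _ en)//; apply: (cvg_norm_le (Hm j)).
by exists n.+1 => // k nk; exact: cH.
Qed.

End Averaging.

(** * Equivariant selections *)

(** Gives access to the lemmas on linear maps for a function that is only
known to be linear. *)
Lemma linear_packed (R : realType) (U W : lmodType R) (f : U -> W) :
  linear f -> exists L : {linear U -> W}, f = L.
Proof.
move=> lf; pose m := GRing.isLinear.Build R U W *:%R f lf.
by pose L : {linear U -> W} := HB.pack f m; exists L.
Qed.

Lemma action_continuous (R : realType) (G : topologicalGroupType)
    (X : normedModType R) (act : G -> X -> X) :
  is_action act -> forall g, continuous (act g).
Proof.
move=> aX g v; apply: (@continuous2_cvg _ _ _ _ _ _ _ _ act).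
- exact: (@act_continuous _ _ _ _ aX (_, _)).
- exact: cvg_cst.
- exact: cvg_id.
Qed.

Lemma actB (R : realType) (G : topologicalGroupType) (X : normedModType R)
    (act : G -> X -> X) : is_action act ->
  forall g u v, act g (u - v) = act g u - act g v.
Proof.
move=> aX g u v; have [L LE] := linear_packed (act_linear aX g).
by rewrite LE linearB.
Qed.

(** Local selections are glued by a partition of unity; the values stay in C x
because C x is convex. *)
Lemma continuous_selection (R : realType) (X Y : normedModType R) (K : set X)
    (C : X -> set Y) :
  compact K -> (forall x, K x -> is_convex (C x)) ->
  (forall x, K x -> exists s : X -> Y, continuous s /\
     \forall x' \near x, K x' -> C x' (s x')) ->
  exists phi : X -> Y, (forall x, K x -> {for x, continuous phi}) /\
    (forall x, K x -> C x (phi x)).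
Proof.
move=> cK cC locC.
pose good (i : X * R * (X -> Y)) := continuous i.2 /\
  forall x, K x -> `|x - i.1.1| < i.1.2 -> C x (i.2 x).
have [n [e He]] : exists (n : nat) (e : 'I_n -> {i | good i}),
    forall x, K x -> exists k, `|x - (sval (e k)).1.1| < (sval (e k)).1.2.
  apply: (compact_finite_selection
    (P := fun x (i : {i | good i}) => `|x - (sval i).1.1| < (sval i).1.2)) => //.
  move=> x /locC[s [cs /nbhs_normP[d /= d0 Hd]]].
  have gi : good (x, d, s).
    by split => //= y Ky yd; apply: Hd => //; rewrite /= distrC.
  exists (exist _ _ gi); apply/nbhs_normP; exists d => //= x'.
  by rewrite /ball_ /= distrC.
pose s k := (sval (e k)).2.
pose t k x := (sval (e k)).1.2 - `|x - (sval (e k)).1.1|.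
(* Twice the positive part of t: positive exactly on the ball on which the
   local selection is admissible. *)
pose w k x := t k x + `|t k x|.
have w0 k x : 0 <= w k x by rewrite /w addrC -lerBlDr sub0r -normrN ler_norm.
have wt k x : 0 < w k x -> 0 < t k x.
  by rewrite /w; case: (ltrP 0 (t k x)) => // tk; rewrite ler0_norm// subrr ltxx.
have W0 x : K x -> 0 < \sum_k w k x.
  move=> /He[k]; rewrite -subr_gt0 -/(t k x) => tk.
  rewrite (bigD1 k)//= ltr_pwDl ?sumr_ge0//.
  by rewrite /w addr_gt0// normr_gt0 gt_eqF.
have cw k : continuous (w k).
  have ct : continuous (t k).
    move=> x; apply: cvgB; first exact: cvg_cst.
    by apply: cvg_norm; apply: cvgB; [exact: cvg_id|exact: cvg_cst].
  by move=> x; apply: cvgD; [exact: ct|apply: cvg_norm; exact: ct].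
exists (fun x => (\sum_k w k x)^-1 *: \sum_k w k x *: s k x); split => x Kx.
  apply: cvgZ.
    apply: cvgV; first by rewrite gt_eqF// W0.
    by apply: cvg_big => [|k _]; [exact: add_continuous|exact: cw].
  apply: cvg_big => [|k _]; first exact: add_continuous.
  by apply: cvgZ; [exact: cw|case: (svalP (e k)) => + _; exact].
apply: convex_sumP => //; [exact: cC|move=> k /wt|exact: W0].
by rewrite subr_gt0; case: (svalP (e k)) => _; exact.
Qed.

(** A form of the tube lemma; it provides the finite nets of G over which
averages are taken. *)
Lemma compact_uniformly_near (R : realType) (S T : topologicalType)
    (Y : normedModType R) (K : set S) (Q : S -> T -> Y) (t0 : T) :
  compact K ->
  (forall s, K s -> {for (s, t0), continuous (fun p => Q p.1 p.2)}) ->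
  forall d : R, 0 < d ->
    \forall t \near t0, forall s, K s -> `|Q s t - Q s t0| < d.
Proof.
move=> /compact_near_coveringP cK cQ d d0.
apply: (cK _ (nbhs t0) (fun t s => `|Q s t - Q s t0| < d)) => s Ks.
have /cvgrPdist_lt /(_ (d / 2)) := cQ s Ks.
rewrite divr_gt0// => /(_ isT)[[U W] /= [Us Wt] UW].
exists (U, W) => // -[s' t'] /= [Us' Wt'].
have h1 := UW (s', t') (conj Us' Wt').
have h2 := UW (s', t0) (conj Us' (nbhs_singleton Wt)).
move: h1 h2 => /= h1 h2.
rewrite -(subrKA (Q s t0)) (le_lt_trans (ler_normD _ _))//.
by move: h1; rewrite distrC; lra.
Qed.

Section EquivariantSelection.
Context {R : realType} {G : topologicalGroupType} {X Y : normedModType R}.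
Context (actX : G -> X -> X) (actY : G -> Y -> Y).
Hypothesis cG : compact [set: G].
Hypothesis aX : is_action actX.
Hypothesis aY : is_action actY.

Lemma invariant_setP (K : set X) :
  invariant_set actX K <-> (forall g x, K x -> K (actX g x)).
Proof.
split=> [KG g x Kx|KG g]; first by rewrite -(KG g); exists x.
apply/seteqP; split => [_ [x Kx <-]|x Kx]; first exact: KG.
exists (actX (g^-1)%g x); first exact: KG.
by rewrite -(actM aX) mulgV (act1 aX).
Qed.

(** The mean over g of g^-1 phi (g x) is equivariant in x. It stays in C x
because each g^-1 phi (g x) belongs to C x, which is closed and convex; it is
continuous as a uniform limit over K of averages of continuous functions. *)
Lemma equivariant_average (K : set X) (phi : X -> Y) (C : X -> set Y) :
  seq_complete Y -> compact K -> invariant_set actX K ->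
  (forall x, K x -> {for x, continuous phi}) ->
  (forall x, K x -> is_convex (C x) /\ closed (C x)) ->
  (forall g x y, K x -> C x y -> C (actX g x) (actY g y)) ->
  (forall x, K x -> C x (phi x)) ->
  exists psi : X -> Y, [/\ {within K, continuous psi},
    equivariant_on actX actY K psi & forall x, K x -> C x (psi x)].
Proof.
move=> cY cK /invariant_setP KG cphi cC CG Cphi.
(* These functions of g are constant exactly when phi is equivariant at x. *)
pose Q (g : G) (x : X) : Y := actY (g^-1)%g (phi (actX g x)).
have cQ g x : K x -> {for (g, x), continuous (fun p => Q p.1 p.2)}.
  move=> Kx; apply: (@continuous2_cvg _ _ _ _ _ _ _ _ (actY)).
  - exact: (@act_continuous _ _ _ _ aY (_, _)).
  - apply: (@cvg_comp _ _ _ fst (fun g => (g^-1)%g)); first exact: cvg_fst.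
    exact: invg_continuous.
  - apply: (@cvg_comp _ _ _ (fun p : G * X => actX p.1 p.2) phi).
      exact: (@act_continuous _ _ _ _ aX (_, _)).
    by apply: cphi; exact: KG.
pose F (x : {x | K x}) (g : G) := Q g (sval x).
have nF (d : R) : 0 < d -> exists2 hs, hs != [::] & is_net F d hs.
  move=> d0.
  pose S := [set: G] `*` [set: G] `*` K.
  have cS : compact S by do 2 apply: compact_setX => //.
  pose Z (p : G * G * X) a := Q (p.1.1 * a * p.1.2)%g p.2.
  have cZ a0 p : S p -> {for (p, a0), continuous (fun q => Z q.1 q.2)}.
    move=> [_ Kp].
    pose A (q : G * G * X * G) := (q.1.1.1 * q.2 * q.1.1.2)%g.
    have cm (f g : G * G * X * G -> G) : continuous f -> continuous g ->
        continuous (fun q => f q * g q)%g.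
      move=> cf cg q; apply: (@continuous2_cvg _ _ _ _ _ _ _ _ (fun x y : G => (x * y)%g)).
      - exact: (@mulg_continuous _ (_, _)).
      - exact: cf.
      - exact: cg.
    have cfst (T1 T2 : topologicalType) : continuous (@fst T1 T2).
      by move=> ?; exact: cvg_fst.
    have csnd (T1 T2 : topologicalType) : continuous (@snd T1 T2).
      by move=> ?; exact: cvg_snd.
    have ccomp (T1 T2 T3 : topologicalType) (f : T1 -> T2) (g : T2 -> T3) :
        continuous f -> continuous g -> continuous (g \o f).
      by move=> cf cg x; exact: (continuous_comp (cf x) (cg _)).
    have c11 : continuous (fun q : G * G * X * G => q.1.1).
      by apply: (ccomp _ _ _ fst fst); exact: cfst.
    have cA : continuous A.
      apply: (cm _ (fun q : G * G * X * G => q.1.1.2)).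
        apply: (cm (fun q : G * G * X * G => q.1.1.1) snd).
          apply: (ccomp _ _ _ (fun q : G * G * X * G => q.1.1) fst) => //; exact: cfst.
        exact: csnd.
      apply: (ccomp _ _ _ (fun q : G * G * X * G => q.1.1) snd).
        exact: c11.
      exact: csnd.
    apply: (@continuous2_cvg _ _ _ _ _ _ _ _ (Q)).
    - exact: cQ.
    - exact: cA.
    - apply: (ccomp _ _ _ fst snd).
        exact: cfst.
      exact: csnd.
  have [n [e He]] : exists (n : nat) (e : 'I_n -> G), forall a, [set: G] a ->
      exists k, forall p, S p -> `|Z p a - Z p (e k)| < d.
    apply: (@compact_finite_selection _ _ _
      (fun a h => forall p, S p -> `|Z p a - Z p h| < d)) => // a _.
    by exists a; apply: compact_uniformly_near => // p Sp; exact: cZ.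
  exists (codom e); last first.
    move=> a; have [k Hk] := He a I; exists (e k); first exact: codom_f.
    by move=> x b g; apply/ltW/(Hk (b, g, sval x)); split => //; exact: svalP.
  have [k _] := He 1%g I.
  by rewrite -size_eq0 size_codom card_ord -lt0n; exact: leq_ltn_trans (ltn_ord k).
have [M HM] : exists M, forall g x, K x -> `|Q g x| <= M.
  have cGK : compact ([set: G] `*` K) by exact: compact_setX.
  move/compact_near_coveringP : cGK => /(_ R +oo
    (fun M p => `|Q p.1 p.2| <= M)) [].
    move=> [g x] /= [_ Kx].
    have /cvgrPdist_lt /(_ 1 ltr01) Qgx := cQ g x Kx.
    exists ([set p | `|Q g x - Q p.1 p.2| < 1], [set M | `|Q g x| + 1 <= M]).
      by split => //=; exact: nbhs_pinfty_ge.
    move=> [[g' x'] M] /= [Qd]; apply: le_trans.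
    rewrite -(subrKC (Q g x) (Q g' x')) (le_trans (ler_normD _ _))// lerD2l distrC.
    exact: ltW.
  by move=> M0 [_ HM]; exists (M0 + 1) => g x Kx; apply: (HM _ _ (g, x)) => //; rewrite ltrDl.
have oF : osc_le F (M + M).
  move=> [x Kx] g g' /=; rewrite /F /= (le_trans (ler_normB _ _))// lerD//; exact: HM.
have [m Hm] := average_exists cY nF oF.
pose psi x := if pselect (K x) is left Kx then m (exist _ x Kx) else 0.
have Hpsi d : 0 < d -> exists2 hs, hs != [::] &
    forall x g, K x -> `|average hs (Q^~ x) g - psi x| <= d.
  move=> /Hm[hs hs0 H]; exists hs => // x g Kx; rewrite /psi.
  by case: pselect => // Kx'; exact: H (exist _ x Kx') g.
exists psi; split.
- apply/subspace_continuousP => x Kx; apply/cvgrPdist_lt => e e0.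
  have [hs hs0 H] := Hpsi (e / 4) ltac:(by rewrite divr_gt0).
  have : {for x, continuous (fun x => average hs (Q^~ x) 1%g)}.
    apply: cvgZ; first exact: cvg_cst.
    apply: cvg_big => [|h _]; first exact: add_continuous.
    apply: (@continuous2_cvg _ _ _ _ _ _ _ _ Q); first exact: cQ.
      exact: cvg_cst.
    exact: cvg_id.
  move=> /cvgrPdist_lt /(_ (e / 2)) /(_ ltac:(by rewrite divr_gt0)).
  apply: filterS => x' h Kx'.
  have h1 := H x 1%g Kx; have h2 := H x' 1%g Kx'.
  rewrite distrC in h1.
  rewrite -(subrKA (average hs (Q^~ x) 1%g)) (le_lt_trans (ler_normD _ _))//.
  rewrite -(subrKA (average hs (Q^~ x') 1%g) (average hs (Q^~ x) 1%g)).
  have := ler_normD (average hs (Q^~ x) 1%g - average hs (Q^~ x') 1%g)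
    (average hs (Q^~ x') 1%g - psi x').
  by move: h h1 h2 => /=; lra.
- move=> k x Kx; have Kkx := KG k x Kx.
  apply/eqP; rewrite -subr_eq0 -normr_le0; apply/ler_addgt0Pr => e e0; rewrite add0r.
  have /cvgrPdist_le /(_ (e / 2)) := action_continuous aY (g := k) (x := psi x).
  rewrite divr_gt0// => /(_ isT) /nbhs_normP[d /= d0 Hd].
  have [hs hs0 H] := Hpsi (Num.min (d / 2) (e / 2))
    ltac:(by rewrite lt_min !divr_gt0).
  have h1 := H _ 1%g Kkx; have h2 := H _ k Kx.
  (* Changing x to k x is a translation of the variable g by k on the right,
     on which the mean does not depend. *)
  have E : average hs (Q^~ (actX k x)) 1%g = actY k (average hs (Q^~ x) k).
    have [L LE] := linear_packed (act_linear aY k).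
    rewrite /average LE linearZ /=; congr (_ *: _); rewrite linear_sum -LE.
    apply: eq_bigr => h _; rewrite /Q mulg1 -(actM aX) -(actM aY).
    by rewrite invgM mulVKg.
  rewrite E in h1.
  have /Hd : ball_ Num.norm (psi x) d (average hs (Q^~ x) k).
    rewrite /ball_ /= distrC (le_lt_trans h2)// gt_min ltr_pdivrMr//.
    by rewrite ltr_pMr// ltr1n.
  rewrite /= => h3; rewrite distrC.
  rewrite -(subrKA (actY k (average hs (Q^~ x) k))) (le_trans (ler_normD _ _))//.
  by move: h1; rewrite le_min => /andP[_]; lra.
- move=> x Kx; have [Cx cCx] := cC x Kx; apply: cCx => B /nbhs_normP[d /= d0 dB].
  have [hs hs0 H] := Hpsi (d / 2) ltac:(by rewrite divr_gt0).
  exists (average hs (Q^~ x) 1%g); split; last first.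
    apply: dB; rewrite /ball_ /= distrC (le_lt_trans (H _ _ Kx))//.
    by rewrite ltr_pdivrMr// ltr_pMr// ltr1n.
  have s0 : 0 < (size hs)%:R :> R by rewrite ltr0n lt0n size_eq0.
  rewrite /average big_tnth.
  have := convex_sumP Cx (w := fun=> 1)
    (y := fun i => Q (tnth (in_tuple hs) i * 1)%g x).
  rewrite sumr_const card_ord; under eq_bigr do rewrite scale1r; apply => // i _.
  rewrite /Q mulg1; set h := tnth _ _.
  have := CG h^-1%g (actX h x) (phi (actX h x)).
  rewrite -(actM aX) mulVg (act1 aX); apply; first exact: KG.
  by apply: Cphi; exact: KG.
Qed.

(** The combination of a partition of unity with averaging over G. It serves
twice: to choose directions of descent in X, and to extend maps into V. *)
Lemma equivariant_selection (K : set X) (C : X -> set Y) :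
  seq_complete Y -> compact K -> invariant_set actX K ->
  (forall x, K x -> is_convex (C x) /\ closed (C x)) ->
  (forall g x y, K x -> C x y -> C (actX g x) (actY g y)) ->
  (forall x, K x -> exists s : X -> Y, continuous s /\
     \forall x' \near x, K x' -> C x' (s x')) ->
  exists psi : X -> Y, [/\ {within K, continuous psi},
    equivariant_on actX actY K psi & forall x, K x -> C x (psi x)].
Proof.
move=> cY cK iK cC CG locC.
have [phi [cphi Cphi]] := continuous_selection cK (fun x Kx => (cC x Kx).1) locC.
exact: equivariant_average Cphi.
Qed.

End EquivariantSelection.

(** * The index as a condition on maps *)

Lemma within_continuous_image_comp (T1 T2 T3 : topologicalType) (A : set T1)
    (h : T1 -> T2) (f : T2 -> T3) :
  {within A, continuous h} -> {within h @` A, continuous f} ->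
  {within A, continuous (f \o h)}.
Proof.
move=> /subspace_continuousP ch /subspace_continuousP cf.
apply/subspace_continuousP => x Ax.
have cfx := cf (h x) (ex_intro2 _ _ x Ax erefl); apply: cvg_comp cfx => W Wh.
have := ch x Ax _ Wh; rewrite /nbhs /= /within /=; apply: filterS => y Wy Ay.
by apply: Wy => //; exists y.
Qed.

Section Index.
Context {R : realType} {G : topologicalGroupType} {X V : normedModType R}.
Context (actX : G -> X -> X) (actV : G -> V -> V).

(** admits_map: *)
(** A map into V^k without zeros, given by its k components, so that only the
norm of V is involved. *)
Definition nonvanishing_map (A : set X) (k : nat) (f : 'I_k -> X -> V) : Prop :=
  [/\ forall i, {within A, continuous f i},
      forall i, equivariant_on actX actV A (f i) &
      forall x, A x -> exists i, f i x != 0].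

Definition admits_map (A : set X) (k : nat) : Prop := exists f, @nonvanishing_map A k f.

(** For nonempty A this says that the index is at least j, as [gindex_geP]
shows; it is meaningful for the empty set too, where it forces j = 0. *)
Definition index_ge (A : set X) (j : nat) : Prop :=
  forall k, admits_map A k -> (j <= k)%N.

Lemma cvg_rowP (T : Type) (F : set_system T) (k : nat) (f : T -> 'rV[V]_k)
    (M : 'rV[V]_k) : Filter F ->
  f x @[x --> F] --> M <-> forall i, f x 0 i @[x --> F] --> M 0 i.
Proof.
move=> FF; split=> [fM i W WM|fM].
  apply: (fM [set N : 'rV[V]_k | W (N 0 i)]).
  exists (fun _ j => if j == i then W else setT) => /=.
    by move=> a j; case: eqP => [->|_]; rewrite ?(ord1 a)//; exact: filterT.
  by move=> N /(_ 0 i); rewrite eqxx.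
move=> W [P PM PW].
have : \forall x \near F, forall i, P 0 i (f x 0 i).
  by apply: filter_forall => i; exact: fM (PM 0 i).
by apply: filterS => x Px; apply: PW => a i; rewrite (ord1 a).
Qed.

Lemma admits_mapP (A : set X) (k : nat) : admits_map A k <->
  exists phi : X -> 'rV[V]_k,
    [/\ {within A, continuous phi}, forall x, A x -> phi x != 0 &
        equivariant_on actX (diag_act actV (k := k)) A phi].
Proof.
split=> [[f [cf ef nf]]|[phi [cphi nphi ephi]]].
  exists (fun x => \row_i f i x); split.
  - apply/subspace_continuousP => x Ax; apply/cvg_rowP => i.
    have /subspace_continuousP/(_ x Ax) := cf i.
    by under eq_fun do rewrite mxE; rewrite mxE.
  - move=> x /nf[i]; apply: contra_neq => /rowP /(_ i).
    by rewrite !mxE.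
  - by move=> g x Ax; apply/rowP => i; rewrite !mxE ef.
exists (fun i x => phi x 0 i); split.
- move=> i; apply/subspace_continuousP => x Ax.
  have /subspace_continuousP/(_ x Ax) cx := cphi.
  by have /cvg_rowP := cx; exact.
- by move=> i g x Ax; rewrite ephi// mxE.
- move=> x /nphi p0; apply: contrapT => H; move: p0; apply/negP/negPn/eqP.
  apply/rowP => i; rewrite mxE; apply/eqP/negPn/negP => fi; apply: H.
  by exists i.
Qed.

Lemma gindex_geP (A : set X) (j : nat) : A !=set0 ->
  (j%:R%:E <= gindex actX actV A)%E <-> index_ge A j.
Proof.
move=> [x0 Ax0]; rewrite /gindex; case: eqP => [A0|_].
  by rewrite A0 in Ax0.
split=> [/ereal_infP H k hk|H].
  rewrite -(ler_nat R) -lee_fin; apply: H; exists k => //; split.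
    by case: k hk => // -[f [_ _ /(_ _ Ax0)]] -[[]].
  exact/admits_mapP.
apply/ereal_infP => _ [k [_ /admits_mapP/H jk] <-].
by rewrite lee_fin ler_nat.
Qed.

Lemma gindex_lty (A : set X) : A !=set0 -> (gindex actX actV A < +oo)%E ->
  exists k, admits_map A k.
Proof.
move=> [x0 Ax0]; rewrite /gindex; case: eqP => [A0|_].
  by rewrite A0 in Ax0.
by move=> /ereal_inf_ltP[_ [k [_ /admits_mapP hk] _] _]; exists k.
Qed.

(** Maps on h(A) pull back to A, so the index cannot decrease under an
equivariant map. *)
Lemma index_ge_image (A : set X) (h : X -> X) (j : nat) :
  {within A, continuous h} -> equivariant_on actX actX A h ->
  index_ge A j -> index_ge (h @` A) j.
Proof.
move=> ch eh Aj k [f [cf ef nf]]; apply: Aj.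
exists (fun i => f i \o h); split.
- by move=> i; exact: within_continuous_image_comp.
- by move=> i g x Ax /=; rewrite eh// ef//; exists x.
- by move=> x Ax; apply: nf; exists x.
Qed.

End Index.

(** * Compact sets and their neighbourhoods *)

(** The property may depend on a parameter that converges along a filter F:
the radius is then common to all parameters far enough along F. *)
Lemma compact_thickening (R : realType) (X : normedModType R) (A : set X)
    (I : Type) (F : set_system I) (P : I -> X -> Prop) : Filter F ->
  compact A -> (forall x, A x -> \forall y \near x & i \near F, P i y) ->
  exists2 d : R, 0 < d &
    \forall i \near F, forall x y, A x -> `|x - y| < d -> P i y.
Proof.
move=> FF /compact_near_coveringP cA HP.
pose P' (p : I * R) x := forall y, `|x - y| < p.2 -> P p.1 y.
have [] := cA _ (filter_prod F (nbhs (0 : R)^'+)) P' _.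
  move=> x /HP[[U W] /= [/nbhs_normP[r /= r0 rU] FW] UW].
  exists (ball_ Num.norm x (r / 2), [set p | W p.1 /\ p.2 < r / 2]).
    split; first by apply/nbhs_normP; exists (r / 2) => //=; rewrite divr_gt0.
    exists (W, [set t | t < r / 2]); last by move=> [].
    by split => //; apply: nbhs_right_lt; rewrite divr_gt0.
  move=> [x' [i t]] /= [xx' [Wi tr]] y x'y; apply: (UW (y, i)); split => //.
  apply: rU; rewrite /ball_ /= -(subrKA x') (le_lt_trans (ler_normD _ _))//.
  by move: xx' x'y tr; rewrite /ball_ /=; lra.
move=> [W D] /= [FW D0 WD].
have [d [Dd d0]] : exists d, D d /\ 0 < d.
  have : \forall d \near (0 : R)^'+, D d /\ 0 < d.
    by near=> d; split; near: d; [exact: D0|exact: nbhs_right_gt].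
  by move=> /filter_ex.
exists d => //; apply: filterS FW => i Wi x y Ax.
exact: (WD (i, d) (conj Wi Dd) x Ax).
Unshelve. all: by end_near.
Qed.

(** Near A everything is controlled on a neighbourhood of A, which contains
all but finitely many B n. *)
Lemma compact_accumulating_union (R : realType) (X : normedModType R)
    (A : set X) (B : nat -> set X) :
  compact A -> (forall n, compact (B n)) ->
  (forall n y, B n y -> exists2 x, A x & `|x - y| < n.+1%:R^-1) ->
  compact (A `|` \bigcup_n B n).
Proof.
move=> cA cB AB; apply/compact_near_coveringP => I F P FF HP.
have [d d0 Fd] := compact_thickening FF cA (fun x Ax => HP x (or_introl Ax)).
have [n0 _ Hn0] := near_infty_natSinv_lt (PosNum d0).
have FB : \forall i \near F, forall n, (n < n0)%N -> B n `<=` P i.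
  elim: n0 {Hn0} => [|n0 IH]; first by apply: nearW.
  have /compact_near_coveringP/(_ _ F P FF) := cB n0.
  move=> /(_ (fun x Bx => HP x (or_intror (ex_intro2 _ _ n0 Logic.I Bx)))).
  apply: filterS2 IH => i H H' n; rewrite ltnS leq_eqVlt => /predU1P[->|]//.
  exact: H.
apply: filterS2 Fd FB => i Hd HB y [Ay|[n _ Bny]].
  by apply: (Hd y) => //; rewrite subrr normr0.
have [nn0|n0n] := ltnP n n0; first exact: HB Bny.
have [x Ax xy] := AB n y Bny; apply: (Hd x) => //; apply: lt_trans xy _.
exact: Hn0.
Qed.

Lemma homo_ltn_leq (s : nat -> nat) : {homo s : m n / (m < n)%N} ->
  forall n, (n <= s n)%N.
Proof. by move=> hs; elim=> // n IH; exact: leq_ltn_trans IH (hs _ _ (ltnSn n)). Qed.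

Lemma cvg_subseq (s : nat -> nat) : {homo s : m n / (m < n)%N} ->
  s n @[n --> \oo] --> \oo.
Proof.
move=> hs W [N _ HN]; exists N => // n /= Nn; apply: HN => /=.
exact: leq_trans Nn (homo_ltn_leq hs n).
Qed.

(** Two consequences of sequential compactness are combined: K has finite
nets, and, for a property holding locally along K, there is a radius (a
Lebesgue number) valid at all points of K. Both are proved by extracting a
subsequence from a sequence of counterexamples. *)
Lemma sequentially_compact (R : realType) (X : normedModType R) (K : set X) :
  (forall u : nat -> X, (forall n, K (u n)) -> exists (s : nat -> nat) (l : X),
     [/\ {homo s : m n / (m < n)%N}, u (s n) @[n --> \oo] --> l & K l]) ->
  compact K.
Proof.
move=> HK.
have TB (e : R) : 0 < e -> exists2 t : seq X, (forall y, y \in t -> K y) &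
    forall x, K x -> exists2 y, y \in t & `|x - y| < e.
  move=> e0; apply: contrapT => H.
  have /choice[S HS] : forall t : seq X, exists x, (forall y, y \in t -> K y) ->
      K x /\ forall y, y \in t -> e <= `|x - y|.
    move=> t; have [tK|ntK] := pselect (forall y, y \in t -> K y); last first.
      by exists 0 => /ntK.
    apply: contrapT => Ht; apply: H; exists t => // x Kx.
    apply: contrapT => Hx; apply: Ht; exists x => _; split => // y yt.
    by rewrite leNgt; apply/negP => xy; apply: Hx; exists y.
  (* Points of K at mutual distance at least e, each chosen from the list of
     its predecessors. *)
  pose L := fix L n := if n is n'.+1 then S (L n') :: L n' else [::].
  have LK n : forall y, y \in L n -> K y.
    elim: n => //= n IH y; rewrite inE => /predU1P[->|]; last exact: IH.
    exact: (HS _ IH).1.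
  have LS m n : (m < n)%N -> S (L m) \in L n.
    elim: n => // n IH; rewrite ltnS leq_eqVlt /= inE => /predU1P[->|/IH ->].
      by rewrite eqxx.
    by rewrite orbT.
  have [s [l [hs sl _]]] := HK (S \o L) (fun n => (HS _ (LK n)).1).
  have [n Hn] := seq_cauchyW (cvg_seq_cauchy sl) (e := e / 2)
    ltac:(by rewrite divr_gt0).
  have := Hn n.+1 n (leqnSn n) (leqnn n).
  have := (HS _ (LK (s n.+1))).2 _ (LS _ _ (hs _ _ (ltnSn n))).
  move=> /= h1 h2; have := le_trans h1 h2; lra.
apply/compact_near_coveringP => I F P FF HP.
have [d d0 Hd] : exists2 d : R, 0 < d & forall x, K x ->
    \forall i \near F, forall y, `|x - y| < d -> P i y.
  apply: contrapT => H.
  have /choice[u Hu] : forall n : nat, exists x, K x /\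
      ~ (\forall i \near F, forall y, `|x - y| < n.+1%:R^-1 -> P i y).
    move=> n; apply: contrapT => Hn; apply: H; exists n.+1%:R^-1 => // x Kx.
    by apply: contrapT => Hx; apply: Hn; exists x.
  have [s [l [hs sl Kl]]] := HK u (fun n => (Hu n).1).
  have [[U W] /= [/nbhs_normP[r /= r0 rU] FW] UW] := HP l Kl.
  have r2 : 0 < r / 2 by rewrite divr_gt0.
  have /cvgrPdist_lt/(_ _ r2) H1 := sl.
  have H2 := cvg_subseq hs (near_infty_natSinv_lt (PosNum r2)).
  have [n [h1 h2]] : exists n, `|l - u (s n)| < r / 2 /\ (s n).+1%:R^-1 < r / 2.
    have H3 : \forall n \near \oo, (s n).+1%:R^-1 < r / 2 by exact: H2.
    by have [n [? ?]] := filter_ex (filterI H1 H3); exists n.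
  apply: (Hu (s n)).2; apply: filterS FW => i Wi y uy.
  apply: (UW (y, i)); split => //; apply: rU; rewrite /ball_ /=.
  by rewrite -(subrKA (u (s n))) (le_lt_trans (ler_normD _ _))//; have := lt_trans uy h2; lra.
have [t tK tc] := TB d d0.
have : \forall i \near F, forall x, x \in t -> forall y, `|x - y| < d -> P i y.
  elim: t tK {tc} => [|x t IH] tK; first by apply: nearW.
  have Kx : K x by apply: tK; rewrite mem_head.
  apply: filterS2 (Hd x Kx) (IH _) => [i h1 h2 z|z zt]; last first.
    by apply: tK; rewrite inE zt orbT.
  by rewrite inE => /predU1P[->|/h2].
apply: filterS => i Hi x /tc[y yt xy]; apply: (Hi y yt).
by rewrite distrC.
Qed.

(** * Subadditivity and continuity of the index *)

Section IndexContinuity.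
Context {R : realType} {G : topologicalGroupType} {X V : normedModType R}.
Context (actX : G -> X -> X) (actV : G -> V -> V).
Hypothesis cG : compact [set: G].
Hypothesis aX : is_action actX.
Hypothesis aV : is_action actV.
Hypothesis cV : seq_complete V.

(** An instance of equivariant selection: the constraint at x is vacuous off
A, and on A asks y to be close to f x along the whole orbit, which makes it
invariant whether or not G acts on V by isometries. Locally the constant f x
is a selection. An approximation is enough below, since a map close to a
nonvanishing one does not vanish. *)
Lemma equivariant_approximate_extension (A K : set X) (f : X -> V) (d : R) :
  compact K -> invariant_set actX K -> closed A -> invariant_set actX A ->
  {within A, continuous f} -> equivariant_on actX actV A f -> 0 < d ->
  exists psi : X -> V, [/\ {within K, continuous psi},
    equivariant_on actX actV K psi & forall x, K x -> A x -> `|psi x - f x| <= d].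
Proof.
move=> cK iK clA /(invariant_setP aX) iA cf ef d0.
pose C x := [set y | A x -> forall g, `|actV g y - f (actX g x)| <= d].
have [] := equivariant_selection cG aX aV (C := C) cV cK iK.
- move=> x Kx; split.
    move=> y z t /andP[t0 t1] Cy Cz Ax g.
    have [L LE] := linear_packed (act_linear aV g).
    have := Cy Ax g; have := Cz Ax g; rewrite LE.
    rewrite linearD !linearZ /= -LE; set u := f _ => hz hy.
    have -> : t *: actV g y + (1 - t) *: actV g z - u =
        t *: (actV g y - u) + (1 - t) *: (actV g z - u).
      rewrite !scalerBr addrACA -opprD -scalerDl subrKC scale1r //.
    rewrite (le_trans (ler_normD _ _))// !normrZ (ger0_norm t0) ger0_norm ?subr_ge0//.
    have -> : d = t * d + (1 - t) * d by rewrite -mulrDl subrKC mul1r.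
    by rewrite lerD// ler_wpM2l// subr_ge0.
  have -> : C x = \bigcap_(g in [set g | A x])
      (fun y => `|actV g y - f (actX g x)|) @^-1` [set r | r <= d].
    apply/seteqP; split => [y Cy g /= Ax|y Cy Ax g]; first exact: Cy.
    exact: Cy.
  apply: closed_bigI => g _; apply: preimage_closed; last exact: closed_le.
  move=> y _; apply: cvg_norm; apply: cvgB; last exact: cvg_cst.
  exact: action_continuous.
- move=> g x y _ Cy /(iA g^-1%g); rewrite -(actM aX) mulVg (act1 aX) => Ax h.
  by rewrite -(actM aX) -(actM aV); exact: Cy.
- move=> x Kx; have [Ax|nAx] := pselect (A x); last first.
    exists (fun=> 0); split; first by move=> y; exact: cvg_cst.
    have : nbhs x (~` A) by apply: open_nbhs_nbhs; split => //; exact: closed_openC.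
    by apply: filterS => y nAy _ /nAy.
  exists (fun=> f x); split; first by move=> y; exact: cvg_cst.
  have H : \forall v \near f x, forall g, [set: G] g ->
      `|actV g v - actV g (f x)| < d.
    apply: compact_uniformly_near => // g _.
    exact: (@act_continuous _ _ _ _ aV (_, _)).
  have /subspace_continuousP/(_ x Ax) /(_ _ H) := cf.
  rewrite /nbhs /= /within /=; apply: filterS => y Hy _ Ay g.
  by rewrite ef// distrC ltW//; exact: Hy.
move=> psi [cpsi epsi Hpsi]; exists psi; split => // x Kx Ax.
have := Hpsi x Kx Ax 1%g; by rewrite (act1 aX) (act1 aV).
Qed.

Lemma nonvanishing_map_bounded_below (A : set X) k (f : 'I_k -> X -> V) :
  compact A -> nonvanishing_map actX actV A f ->
  exists2 d : R, 0 < d & forall x, A x -> exists i, d < `|f i x|.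
Proof.
move=> /compact_near_coveringP cA [cf _ nf].
have [] := cA _ (nbhs (0 : R)^'+) (fun d x => A x -> exists i, d < `|f i x|) _.
  move=> x Ax; have [i fi] := nf x Ax.
  have fi0 : 0 < `|f i x| / 2 by rewrite divr_gt0// normr_gt0.
  have /subspace_continuousP/(_ x Ax)/cvgrPdist_lt/(_ _ fi0) := cf i.
  rewrite /within /= => Hf.
  exists ([set y | A y -> `|f i x - f i y| < `|f i x| / 2],
    [set d | d < `|f i x| / 2]).
    by split => //=; exact: nbhs_right_lt.
  move=> [y d] /= [Hy dx] Ay; exists i.
  have := Hy Ay; have := ler_normD (f i y) (f i x - f i y).
  by move: dx; rewrite subrKC /=; lra.
move=> d /= d0 Hd; exists (d / 2); first by rewrite divr_gt0.
move=> x Ax; have d2 : 0 < d / 2 by rewrite divr_gt0.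
apply: (Hd (d / 2)) => //=; rewrite sub0r normrN gtr0_norm// ltr_pdivrMr//.
by rewrite ltr_pMr// ltr1n.
Qed.

Lemma nonvanishing_map_extension (A K : set X) k (f : 'I_k -> X -> V) :
  compact K -> invariant_set actX K -> compact A -> invariant_set actX A ->
  A `<=` K -> nonvanishing_map actX actV A f ->
  exists psi : 'I_k -> X -> V, [/\ forall i, {within K, continuous psi i},
    forall i, equivariant_on actX actV K (psi i) &
    forall x, A x -> exists i, psi i x != 0].
Proof.
move=> cK iK cA iA AK fA; have [d d0 Hd] := nonvanishing_map_bounded_below cA fA.
have [cf ef _] := fA.
have clA : closed A by apply: compact_closed => //; exact: norm_hausdorff.
have /choice[psi Hpsi] : forall i, exists psi : X -> V,
    [/\ {within K, continuous psi}, equivariant_on actX actV K psi &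
    forall x, K x -> A x -> `|psi x - f i x| <= d].
  by move=> i; exact: equivariant_approximate_extension.
exists psi; split.
- by move=> i; have [] := Hpsi i.
- by move=> i; have [] := Hpsi i.
- move=> x Ax; have [i fi] := Hd x Ax; exists i; apply/eqP => p0.
  have [_ _ /(_ x (AK x Ax) Ax)] := Hpsi i.
  by rewrite p0 sub0r normrN leNgt fi.
Qed.

(** Extend both maps to the union and juxtapose their components: at each
point of the union one of the two does not vanish. *)
Lemma admits_map_union (A B : set X) (k l : nat) :
  compact A -> invariant_set actX A -> compact B -> invariant_set actX B ->
  admits_map actX actV A k -> admits_map actX actV B l ->
  admits_map actX actV (A `|` B) (k + l).
Proof.
move=> cA iA cB iB [f fA] [h hB].
have cK : compact (A `|` B) by exact: compactU.
have iK : invariant_set actX (A `|` B).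
  apply/(invariant_setP aX) => g x [Ax|Bx]; [left|right].
    by move/(invariant_setP aX) : iA; apply.
  by move/(invariant_setP aX) : iB; apply.
have [f' [cf ef nf]] := nonvanishing_map_extension cK iK cA iA (@subsetUl _ A B) fA.
have [h' [ch eh nh]] := nonvanishing_map_extension cK iK cB iB (@subsetUr _ A B) hB.
exists (fun i => match fintype.split i with inl a => f' a | inr b => h' b end); split.
- by move=> i; case: fintype.split.
- by move=> i; case: fintype.split.
- move=> x [/nf[i Hi]|/nh[i Hi]].
    by exists (lshift l i); rewrite (unsplitK (inl i)).
  by exists (rshift k i); rewrite (unsplitK (inr i)).
Qed.

(** If this failed, sets B n without such a map would accumulate on A.
Together with A they form a compact set, to which the map on A extends; the
extension does not vanish near A, hence not on B n for large n. Working with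
this union avoids extending the map to a set that is not compact. *)
Lemma admits_map_neighborhood (A : set X) (k : nat) :
  compact A -> invariant_set actX A -> admits_map actX actV A k ->
  exists2 d : R, 0 < d & forall B, compact B -> invariant_set actX B ->
    (forall y, B y -> exists2 x, A x & `|x - y| < d) -> admits_map actX actV B k.
Proof.
move=> cA iA [f fA]; apply: contrapT => H.
have /choice[B HB] : forall n : nat, exists B, [/\ compact B, invariant_set actX B,
    forall y, B y -> exists2 x, A x & `|x - y| < n.+1%:R^-1 & ~ admits_map actX actV B k].
  move=> n; apply: contrapT => Hn; apply: H; exists n.+1%:R^-1 => // B cB iB AB.
  by apply: contrapT => nB; apply: Hn; exists B.
pose K := A `|` \bigcup_n B n.
have cK : compact K.
  by apply: compact_accumulating_union => // n; have [] := HB n.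
have iK : invariant_set actX K.
  apply/(invariant_setP aX) => g x [Ax|[n _ Bx]]; [left|right].
    by move/(invariant_setP aX) : iA; apply.
  by exists n => //; have [_ /(invariant_setP aX) + _ _] := HB n; apply.
have [psi [cpsi epsi npsi]] := nonvanishing_map_extension cK iK cA iA (@subsetUl _ _ _) fA.
have [|d d0 Hd] := @compact_thickening _ _ A _ \oo
    (fun (n : nat) y => K y -> exists i, psi i y != 0) _ cA.
  move=> x Ax; have [i pi0] := npsi x Ax.
  have pi1 : 0 < `|psi i x| by rewrite normr_gt0.
  have /subspace_continuousP/(_ x (or_introl Ax))/cvgrPdist_lt/(_ _ pi1) := cpsi i.
  rewrite /within /= => Hp.
  exists ([set y | K y -> `|psi i x - psi i y| < `|psi i x|], setT).
    by split => //; exact: filterT.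
  move=> [y n] /= [Hy _] Ky; exists i; apply/eqP => p0.
  by have := Hy Ky; rewrite p0 subr0 ltxx.
have : \forall n \near \oo, n.+1%:R^-1 < d by exact: near_infty_natSinv_lt (PosNum d0).
move=> /(filterI Hd) /filter_ex[n [Hn nd]].
have [_ _ AB] := HB n; apply.
exists psi; split.
- move=> i; apply: continuous_subspaceW (cpsi i) => y By; right; by exists n.
- move=> i g x Bx; apply: epsi; right; by exists n.
- move=> y By; have [x Ax xy] := AB y By.
  apply: (Hn x) => //; first exact: lt_trans nd.
  by right; exists n.
Qed.

End IndexContinuity.

(** * Ekeland's variational principle *)

(** The order x <= y iff dist (x, y) <= (F x - F y) / e is followed along a
sequence which at each step realises at least half of the possible decrease of
F. Distance enters only through the relation dist_le x y r, which says that it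
is at most r; this dispenses with suprema when the points are functions.
Completeness and lower semicontinuity are joined in one hypothesis, on
sequences along which F decreases. *)
Lemma ekeland_principle (R : realType) (T : Type) (D : set T)
    (dist_le : T -> T -> R -> Prop) (F : T -> R) (m e : R) (x0 : T) :
  (forall x, D x -> dist_le x x 0) ->
  (forall x y z r s, dist_le x y r -> dist_le y z s -> dist_le x z (r + s)) ->
  (forall x y r s, r <= s -> dist_le x y r -> dist_le x y s) ->
  (forall x, D x -> m <= F x) ->
  (forall (u : nat -> T) (r : nat -> R), (forall n, D (u n)) ->
     (forall n k, dist_le (u n) (u (n + k)%N) (r n)) ->
     r n @[n --> \oo] --> (0 : R) -> (forall n, F (u n.+1) <= F (u n)) ->
     exists2 x, D x & forall n, dist_le (u n) x (r n) /\ F x <= F (u n)) ->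
  0 < e -> D x0 ->
  exists x, [/\ D x, F x <= F x0, dist_le x0 x ((F x0 - F x) / e) &
    forall y r, 0 < r -> D y -> dist_le x y r -> F x - e * r < F y].
Proof.
move=> drefl dtrans dmono mF cD e0 Dx0.
pose le x y := [/\ D y, F y <= F x & dist_le x y ((F x - F y) / e)].
have le_refl x : D x -> le x x.
  by move=> Dx; split => //; rewrite subrr mul0r; exact: drefl.
have letr x y z : le x y -> le y z -> le x z.
  move=> [Dy yx xy] [Dz zy yz]; split => //; first exact: le_trans zy yx.
  by have := dtrans _ _ _ _ _ xy yz; rewrite -mulrDl subrKA.
have step x : exists y, D x -> le x y /\ forall z, le x z -> F y <= (F x + F z) / 2.
  have [Dx|nDx] := pselect (D x); last by exists x.
  pose E := [set F z | z in le x].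
  have hE : has_inf E.
    split; first by exists (F x), x => //; exact: le_refl.
    by exists m => _ [z [Dz _ _] <-]; exact: mF.
  have Fi z : le x z -> inf E <= F z by move=> xz; apply: (ge_inf hE.2); exists z.
  have [xi|ix] := leP (F x) (inf E).
    exists x => _; split; first exact: le_refl.
    by move=> z /Fi iz; lra.
  have [|_ [y xy <-] yi] := @inf_adherent _ E ((F x - inf E) / 2) _ hE.
    by rewrite divr_gt0// subr_gt0.
  by exists y => _; split => // z /Fi iz; lra.
have [S HS] := choice step.
pose u n := iter n S x0.
have Du n : D (u n).
  by elim: n => //= n /HS[[]].
have leu n k : le (u n) (u (n + k)%N).
  elim: k => [|k IH]; first by rewrite addn0; exact: le_refl.
  by apply: letr IH _; rewrite addnS; exact: (HS _ (Du _)).1.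
have uS n : F (u n.+1) <= F (u n) by have [_ + _] := leu n 1%N; rewrite addn1.
have nu : nonincreasing_seq (F \o u) by apply/nonincreasing_seqP.
have lu : has_lbound (range (F \o u)) by exists m => _ [n _ <-]; exact: mF.
have cu := nonincreasing_is_cvgn nu lu.
pose l := limn (F \o u).
have ul n : l <= F (u n) := nonincreasing_cvgn_ge nu cu n.
have [||x Dx Hx] := cD u (fun n => (F (u n) - l) / e) Du _ _ uS.
- move=> n k; have [_ _] := leu n k; apply: dmono.
  by rewrite ler_pM2r ?invr_gt0// lerD2l lerN2.
- rewrite -(mul0r e^-1) -(subrr l); apply: cvgMl; apply: cvgB => //.
  exact: cvg_cst.
have xl : F x <= l by apply: limr_ge => //; apply: nearW => n; exact: (Hx n).2.
have ux n : le (u n) x.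
  split=> //; first exact: (Hx n).2.
  by apply: dmono (Hx n).1; rewrite ler_pM2r ?invr_gt0// lerD2l lerN2.
exists x; have [_ Fx dx] := ux 0%N; split => // y r r0 Dy xy.
rewrite ltNge; apply/negP => Fy.
have er : 0 < e * r by rewrite mulr_gt0.
have xley : le x y.
  split => //; first by lra.
  by apply: dmono xy; rewrite ler_pdivlMr//; lra.
have /cvgrPdist_lt /(_ _ er)[n _ /(_ n (leqnn n))/=] := cu.
rewrite -/l distrC ger0_norm ?subr_ge0// => un.
have := (HS _ (Du n)).2 y (letr _ _ _ (ux n) xley).
by have := ul n.+1; rewrite /u /=; rewrite /u /= in un; lra.
Qed.

(** * Continuously differentiable functionals on compact sets *)

Section Differential.
Context {R : realType} {X : normedModType R} (Phi : X -> R).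
Hypothesis cPhi : continuously_differentiable Phi.

Lemma is_derive_along_line (u y : X) (t : R) :
  is_derive t 1 (fun t : R => Phi (u + t *: y)) ('d Phi (u + t *: y) y).
Proof.
have E : (fun h : R => h^-1 *: (((fun t : R => Phi (u + t *: y)) \o shift t)
      (h *: 1) - Phi (u + t *: y))) =
    (fun h : R => h^-1 *: ((Phi \o shift (u + t *: y)) (h *: y) -
      Phi (u + t *: y))).
  apply/funext => h /=; congr (_ *: (Phi _ - _)).
  by rewrite [h *: 1]mulr1 scalerDl addrCA.

split; first by rewrite /derivable E; apply: diff_derivable; exact: cPhi.1.
by rewrite -deriveE; [rewrite /derive E|exact: cPhi.1].
Qed.

(** The evaluation of the differential is jointly continuous, because the
differential is continuous for the operator norm. *)
Lemma cvg_differential (T : Type) (F : set_system T) (f h : T -> X) (u w : X) :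
  Filter F -> f x @[x --> F] --> u -> h x @[x --> F] --> w ->
  'd Phi (f x) (h x) @[x --> F] --> 'd Phi u w.
Proof.
move=> FF fu hw; apply/cvgrPdist_lt => e e0.
have w1 : 0 < `|w| + 1 by rewrite ltr_wpDl.
have cd : 'd Phi u (h x) @[x --> F] --> 'd Phi u w.
  by apply: continuous_cvg hw; apply: diff_continuous; exact: cPhi.1.
have e2 : 0 < e / 2 by rewrite divr_gt0.
have e3 : 0 < e / 2 / (`|w| + 1) by rewrite divr_gt0.
have /cvgrPdist_lt /(_ _ e2) H1 := cd.
have H2 := fu _ (cPhi.2 u _ e3).
have H3 : \forall x \near F, `|h x| < `|w| + 1.
  by apply: (cvgr_norm_lt _ hw); rewrite ltrDl.
near=> x.
have h1 : `|'d Phi u w - 'd Phi u (h x)| < e / 2 by near: x.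
have h2 : forall v, `|'d Phi (f x) v - 'd Phi u v| <= e / 2 / (`|w| + 1) * `|v|.
  by near: x.
have h3 : `|h x| < `|w| + 1 by near: x.
rewrite -(subrKA ('d Phi u (h x))) (le_lt_trans (ler_normD _ _))//.
have : `|'d Phi u (h x) - 'd Phi (f x) (h x)| <= e / 2.
  rewrite distrC (le_trans (h2 _))// mulrAC -mulrA -{2}[e / 2]mulr1.
  by rewrite ler_wpM2l ?(ltW e2)// ler_pdivrMr// mul1r ltW.
lra.
Unshelve. all: by end_near.
Qed.

(** By the mean value theorem the error is the variation of the differential
on the segment from u to u + y, which is uniformly small near a compact set.
*)
Lemma compact_uniformly_differentiable (A : set X) (s : R) : compact A -> 0 < s ->
  exists2 d : R, 0 < d & forall u y, A u -> `|y| < d ->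
    `|Phi (u + y) - Phi u - 'd Phi u y| <= s * `|y|.
Proof.
move=> /compact_near_coveringP cA s0.
have [] := cA _ (nbhs (0 : R)^'+) (fun d u => forall y, `|y| < d ->
    `|Phi (u + y) - Phi u - 'd Phi u y| <= s * `|y|) _.
  move=> u0 Au0; have s2 : 0 < s / 2 by rewrite divr_gt0.
  have /nbhs_normP[r /= r0 Hr] := cPhi.2 u0 _ s2.
  have r2 : 0 < r / 2 by rewrite divr_gt0.
  exists (ball_ Num.norm u0 (r / 2), [set d | d < r / 2]).
    split => /=; first by apply/nbhs_normP; exists (r / 2).
    exact: nbhs_right_lt.
  move=> [u d] /= [uu0 dr] y yd.
  have [|||c c01] := @MVT_segment R (fun t : R => Phi (u + t *: y))
      (fun t => 'd Phi (u + t *: y) y) 0 1.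
  - exact: ler01.
  - by move=> t _; exact: is_derive_along_line.
  - apply: derivable_within_continuous => t _.
    by have [] := is_derive_along_line u y t.
  rewrite scale0r addr0 scale1r subr0 mulr1 => ->.
  move: c01; rewrite in_itv /= => /andP[c0 c1].
  have h1 : `|'d Phi (u + c *: y) y - 'd Phi u0 y| <= s / 2 * `|y|.
    apply: Hr; rewrite /ball_ /= opprD addrA (le_lt_trans (ler_normB _ _))//.
    rewrite normrZ ger0_norm//.
    have : c * `|y| <= `|y| by rewrite ler_piMl.
    by move: uu0; rewrite /ball_ /=; lra.
  have h2 : `|'d Phi u y - 'd Phi u0 y| <= s / 2 * `|y|.
    by apply: Hr; rewrite /ball_ /=; move: uu0; rewrite /ball_ /=; lra.
  rewrite distrC in h2.
  by rewrite -(subrKA ('d Phi u0 y)) (le_trans (ler_normD _ _))//; lra.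
move=> d /= d0 Hd; exists (d / 2); first by rewrite divr_gt0.
move=> u y Au; have d2 : 0 < d / 2 by rewrite divr_gt0.
apply: (Hd (d / 2)) => //=; rewrite sub0r normrN gtr0_norm// ltr_pdivrMr//.
by rewrite ltr_pMr// ltr1n.
Qed.

Lemma invariant_differential {G : topologicalGroupType} (act : G -> X -> X) :
  is_action act -> invariant_fun act Phi ->
  forall g u z, 'd Phi (act g u) (act g z) = 'd Phi u z.
Proof.
move=> aX iPhi g u z; rewrite -!deriveE; [|exact: cPhi.1..].
rewrite /derive; suff -> : (fun h : R => h^-1 *: ((Phi \o shift (act g u))
    (h *: act g z) - Phi (act g u))) =
  (fun h : R => h^-1 *: ((Phi \o shift u) (h *: z) - Phi u)) by [].
apply/funext => h /=.
have [L LE] := linear_packed (act_linear aX g).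
congr (_ *: (_ - _)); last exact: iPhi.
by rewrite /shift /= -(iPhi g (h *: z + u)) LE linearD linearZ.
Qed.

End Differential.

Lemma lte_real_between (R : realType) (x : R) (y : \bar R) : (x%:E < y)%E ->
  exists2 a : R, x < a & (a%:E < y)%E.
Proof.
case: y => [q| |]; last by rewrite ltNge leNye.
  by rewrite lte_fin => xq; exists ((x + q) / 2); rewrite ?lte_fin; lra.
by move=> _; exists (x + 1); rewrite ?ltrDl// ltry.
Qed.

(** * Directions of descent *)

Section Descent.
Context {R : realType} {X : normedModType R} (Phi : X -> R) (Psi : X -> \bar R).
Hypothesis cPhi : continuously_differentiable Phi.
Hypothesis Psi_gtNy : forall u, (-oo < Psi u)%E.
Hypothesis convPsi : ereal_convex Psi.
Hypothesis lscPsi : lower_semicontinuous Psi.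

(** Moving from u by z changes the convexified functional, where Phi is
replaced by its linear part, by at most b. Written so that no infinite value
is subtracted. *)
Definition descent (u z : X) (b : R) : Prop :=
  (('d Phi u z)%:E + Psi (u + z)%R <= Psi u + b%:E)%E.

Lemma Psi_finP (u : X) : (Psi u < +oo)%E -> exists p, Psi u = p%:E.
Proof.
by case E : (Psi u) (Psi_gtNy u) => [p| |]// _ _; exists p.
Qed.

Lemma descentP (u z : X) (b p : R) : Psi u = p%:E -> descent u z b ->
  exists2 q, Psi (u + z) = q%:E & 'd Phi u z + q <= p + b.
Proof.
rewrite /descent => ->; case E : (Psi (u + z)) (Psi_gtNy (u + z)) => [q| |]// _ H.
by exists q => //; move: H; rewrite -EFinD lee_fin.
Qed.

Lemma descent_le (u z : X) (b c : R) : b <= c -> descent u z b -> descent u z c.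
Proof.
by rewrite /descent => bc /le_trans; apply; rewrite leeD2l// lee_fin.
Qed.

Lemma descent_convex (u y z : X) (b c t : R) : (Psi u < +oo)%E ->
  0 <= t <= 1 -> descent u y b -> descent u z c ->
  descent u (t *: y + (1 - t) *: z) (t * b + (1 - t) * c).
Proof.
move=> /Psi_finP[p Ep] t01 /(descentP Ep)[q Eq Hq] /(descentP Ep)[r Er Hr].
have := convPsi (u + y) (u + z) t01; rewrite Eq Er.
have -> : t *: (u + y) + (1 - t) *: (u + z) = u + (t *: y + (1 - t) *: z).
  by rewrite !scalerDr addrACA -scalerDl subrKC scale1r.
rewrite /descent Ep -!EFinM -!EFinD.
case: (Psi _) => [s| |]; last 2 first.
- by rewrite leye_eq.
- by rewrite addeNy !leNye.
rewrite lee_fin => Hs.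
rewrite linearD !linearZ /= -!EFinD lee_fin.
case/andP: t01 => t0 t1; have t1' : 0 <= 1 - t by rewrite subr_ge0.
have := ler_wpM2l t0 Hq; have := ler_wpM2l t1' Hr; rewrite /GRing.scale/=; lra.
Qed.

Lemma descent_scale (u z : X) (b t : R) : (Psi u < +oo)%E ->
  0 <= t <= 1 -> descent u z b -> descent u (t *: z) (t * b).
Proof.
move=> Pu t01 uz.
have u0 : descent u 0 0.
  by rewrite /descent linear0 add0e !addr0.
by have := descent_convex Pu t01 uz u0; rewrite scaler0 mulr0 !addr0.
Qed.

(** The inequality defines a sublevel set of a lower semicontinuous function
of z. *)
Lemma descent_closed (u : X) (b : R) : (Psi u < +oo)%E ->
  closed [set z | descent u z b].
Proof.
move=> /Psi_finP[p Ep] z clz; apply: contrapT; rewrite /descent Ep => /negP.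
rewrite -ltNge -EFinD => lt.
have lt1 : ((p + b - 'd Phi u z)%:E < Psi (u + z)%R)%E.
  by rewrite EFinB lteBlDl.
have [a a1 a2] := lte_real_between lt1.
have [W nW HW] := lscPsi a2.
have cd : 'd Phi u z' @[z' --> z] --> 'd Phi u z.
  by apply: (cvg_differential cPhi); [exact: cvg_cst|exact: cvg_id].
have cu : (u + z') @[z' --> z] --> u + z by apply: cvgD; [exact: cvg_cst|exact: cvg_id].
have l0 : 0 < a - (p + b - 'd Phi u z) by rewrite subr_gt0.
have /cvgrPdist_lt /(_ _ l0) H1 := cd.
have H2 : \forall z' \near z, W (u + z') by exact: cu nW.
have [z' [dz' [/HW Wz' h1]]] := clz _ (filterI H2 H1).
have [q Eq Hq] := descentP Ep dz'.
move: Wz' h1; rewrite Eq lte_fin => Wz' /= /(le_lt_trans (ler_norm _)).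
lra.
Qed.

(** The target v is fixed, so the inequality depends on u through a continuous
term and - Psi u, which is upper semicontinuous: strict validity at u persists
nearby. This is what makes local choices possible although Psi is not
continuous. *)
Lemma descent_near (u v : X) (b : R) :
  (('d Phi u (v - u))%:E + Psi v < Psi u + b%:E)%E ->
  \forall u' \near u, descent u' (v - u') b.
Proof.
move=> H.
have [q Eq] : exists q, Psi v = q%:E.
  apply: Psi_finP; rewrite ltNge leye_eq; apply/eqP => E.
  by move: H; rewrite E addey// ltNge leey.
have lt1 : (('d Phi u (v - u) + q - b)%:E < Psi u)%E.
  by rewrite EFinB lteBlDr// EFinD -Eq.
have [a a1 a2] := lte_real_between lt1.
have [W nW HW] := lscPsi a2.
have cd : 'd Phi u' (v - u') @[u' --> u] --> 'd Phi u (v - u).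
  apply: (cvg_differential cPhi); first exact: cvg_id.
  by apply: cvgB; [exact: cvg_cst|exact: cvg_id].
have l0 : 0 < a - ('d Phi u (v - u) + q - b) by rewrite subr_gt0.
have /cvgrPdist_lt /(_ _ l0) H1 := cd.
apply: filterS2 nW H1 => u' /HW Pu' h1; rewrite /descent subrKC Eq.
rewrite -leeBlDr//; apply: le_trans (ltW Pu'); rewrite -EFinD lee_fin.
by move: h1 => /=; rewrite distrC => /(le_lt_trans (ler_norm _)); lra.
Qed.

End Descent.

(** * Equivariant deformations *)

Section Deformation.
Context {R : realType} {G : topologicalGroupType} {X : completeNormedModType R}.
Context (actX : G -> X -> X) (Phi : X -> R) (Psi : X -> \bar R).
Hypothesis cG : compact [set: G].
Hypothesis aX : is_action actX.
Hypothesis isoX : is_isometric actX.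
Hypothesis cPhi : continuously_differentiable Phi.
Hypothesis Psi_gtNy : forall u, (-oo < Psi u)%E.
Hypothesis convPsi : ereal_convex Psi.
Hypothesis lscPsi : lower_semicontinuous Psi.
Hypothesis iPhi : invariant_fun actX Phi.
Hypothesis iPsi : invariant_fun actX Psi.
Let I := functional Phi Psi.

Lemma functional_invariant : invariant_fun actX I.
Proof. by move=> g x; rewrite /I /functional iPhi iPsi. Qed.

(** At height at least a the direction z decreases the functional at rate 2 e
with respect to the scale r; at lower points it is only required not to
increase it by more than 1, which is harmless after a short step. *)
Definition good_descent (a e : R) (u z : X) (r : R) : Prop :=
  [/\ `|z| <= r, descent Phi Psi u z 1 &
      (a%:E <= I u)%E -> descent Phi Psi u z (- (2 * e * r))].

Lemma good_descent_scale (a e r s : R) (u z : X) : (Psi u < +oo)%E ->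
  0 < s -> s <= r -> good_descent a e u z r ->
  good_descent a e u ((s / r) *: z) s.
Proof.
move=> Pu s0 sr [zr d1 d2]; have r0 : 0 < r by exact: lt_le_trans sr.
have t01 : 0 <= s / r <= 1.
  by rewrite divr_ge0 ?(ltW s0) ?(ltW r0)//= ler_pdivrMr// mul1r.
have /andP[t0 t1] := t01.
split.
- rewrite normrZ ger0_norm// mulrAC ler_pdivrMr//.
  by rewrite ler_wpM2l// ltW.
- by apply: (descent_le _ (descent_scale Psi_gtNy convPsi Pu t01 d1)); rewrite mulr1.
- move=> /d2/(descent_scale Psi_gtNy convPsi Pu t01); apply: descent_le.
  by rewrite mulrN lerN2 mulrCA mulfVK ?gt_eqF.
Qed.

(** If u is at height at least a, a target violating the Palais-Smale
inequality at u works for all nearby points. If u is below a, the target u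
itself works: by lower semicontinuity I can jump up near u, but then moving
back to u gains at least a fixed part of a - I u, over an arbitrarily small
distance. *)
Lemma good_descent_near (a e : R) (A : set X) (u : X) : 0 < e ->
  (forall x, A x -> (Psi x < +oo)%E) -> A u ->
  ((a%:E <= I u)%E -> exists v,
     (('d Phi u (v - u)%R)%:E + Psi v - Psi u < (- (4 * e * `|v - u|))%:E)%E) ->
  exists v (r : R), 0 < r /\
    \forall u' \near u, A u' -> good_descent a e u' (v - u') r.
Proof.
move=> e0 PA Au Hu; have [p Ep] := Psi_finP Psi_gtNy (PA u Au).
have [au|au] := leP a%:E (I u).
  have [v] := Hu au; rewrite Ep lteBlDr// => Hv.
  have vu : 0 < `|v - u|.
    rewrite normr_gt0; apply/eqP => vu0; move: Hv.
    by rewrite vu0 normr0 mulr0 oppr0 linear0 !add0e (subr0_eq vu0) Ep ltxx.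
  exists v, (2 * `|v - u|); split; first by rewrite mulr_gt0.
  have H1 := descent_near cPhi Psi_gtNy lscPsi
    (u := u) (v := v) (b := - (4 * e * `|v - u|)).
  rewrite Ep [X in (_ < X)%E]addeC in H1; have {}H1 := H1 Hv.
  have cn : `|v - u'| @[u' --> u] --> `|v - u|.
    by apply: cvg_norm; apply: cvgB; [exact: cvg_cst|exact: cvg_id].
  have /cvgrPdist_lt/(_ _ vu) H2 := cn.
  apply: filterS2 H1 H2 => u' d1 d2 Au'.
  have E : - (2 * e * (2 * `|v - u|)) = - (4 * e * `|v - u|) by lra.
  split.
  - by move: d2; rewrite distrC => /(le_lt_trans (ler_norm _)) /=; lra.
  - apply: (descent_le _ d1); apply: (@le_trans _ _ 0) => //.
    by rewrite oppr_le0 !mulr_ge0// ltW.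
  - by rewrite E.
(* k is the gap below height a; the scale k / (4 e) makes the required gain 2
   e r equal to k / 2. *)
have [k k0 Ek] : exists2 k, 0 < k & p = a - k - Phi u.
  move: au; rewrite /I /functional Ep -EFinD lte_fin => au.
  by exists (a - (Phi u + p)); [rewrite subr_gt0|lra].
have e4 : 0 < 4 * e by rewrite mulr_gt0.
have k4 : 0 < k / (4 * e) by rewrite divr_gt0.
exists u, (k / (4 * e)); split => //.
have H1 : \forall u' \near u, descent Phi Psi u' (u - u') 1.
  apply: descent_near => //.
  by rewrite subrr linear0 add0e Ep -EFinD lte_fin ltrDl.
have H2 : \forall u' \near u, `|u - u'| < k / (4 * e).
  by apply/nbhs_normP; exists (k / (4 * e)).
have kk : 0 < k / 4 by rewrite divr_gt0.
have cP : Phi u' @[u' --> u] --> Phi u.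
  by apply: differentiable_continuous; exact: cPhi.1.
have /cvgrPdist_lt/(_ _ kk) H3 := cP.
have cd : 'd Phi u' (u - u') @[u' --> u] --> 'd Phi u (u - u).
  apply: (cvg_differential cPhi); first exact: cvg_id.
  by apply: cvgB; [exact: cvg_cst|exact: cvg_id].
have /cvgrPdist_lt/(_ _ kk) H4 := cd.
near=> u' => Au'.
have h1 : descent Phi Psi u' (u - u') 1 by near: u'.
have h2 : `|u - u'| < k / (4 * e) by near: u'.
have h3 : `|Phi u - Phi u'| < k / 4 by near: u'.
have h4 : `|'d Phi u (u - u) - 'd Phi u' (u - u')| < k / 4 by near: u'.
split; [exact: ltW|exact: h1|].
have [q Eq] := Psi_finP Psi_gtNy (PA u' Au').
rewrite /I /functional /descent Eq subrKC Ep -!EFinD !lee_fin => aq.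
have -> : 2 * e * (k / (4 * e)) = k / 2.
  by field; rewrite gt_eqF.
have {}h3 : Phi u' - Phi u < k / 4.
  by move: h3; rewrite distrC => /(le_lt_trans (ler_norm _)).
move: h4; rewrite subrr linear0 sub0r normrN => /(le_lt_trans (ler_norm _)).
by lra.
Unshelve. all: by end_near.
Qed.

(** The scales found locally are bounded below on a compact set, so that all
directions can be shortened to a common scale. *)
Lemma good_descent_uniform (A : set X) (a e : R) : compact A -> 0 < e ->
  (forall u, A u -> (Psi u < +oo)%E) ->
  (forall u, A u -> (a%:E <= I u)%E -> exists v,
     (('d Phi u (v - u)%R)%:E + Psi v - Psi u < (- (4 * e * `|v - u|))%:E)%E) ->
  exists2 r : R, 0 < r & forall u, A u -> exists v s,
    r <= s /\ \forall u' \near u, A u' -> good_descent a e u' (v - u') s.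
Proof.
move=> /compact_near_coveringP cA e0 PA Hu.
have [] := cA _ (nbhs (0 : R)^'+) (fun r u => A u -> exists v s,
    r <= s /\ \forall u' \near u, A u' -> good_descent a e u' (v - u') s) _.
  move=> u Au; have [v [s [s0 H]]] := good_descent_near e0 PA Au (Hu u Au).
  exists ([set u' | \forall u'' \near u', A u'' -> good_descent a e u'' (v - u'') s],
    [set r | r < s]).
    by split; [exact: near_join|exact: nbhs_right_lt].
  by move=> [u' r] /= [H' rs] Au'; exists v, s; split => //; exact: ltW.
move=> d /= d0 Hd; exists (d / 2); first by rewrite divr_gt0.
move=> u Au; have d2 : 0 < d / 2 by rewrite divr_gt0.
apply: (Hd (d / 2)) => //=; rewrite sub0r normrN gtr0_norm// ltr_pdivrMr//.
by rewrite ltr_pMr// ltr1n.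
Qed.

(** The admissible directions at u form a closed convex set, by convexity and
lower semicontinuity of Psi, and invariance of the functional makes this
family of sets equivariant. *)
Lemma equivariant_descent_field (A : set X) (a e r : R) :
  compact A -> invariant_set actX A -> 0 < r ->
  (forall u, A u -> (Psi u < +oo)%E) ->
  (forall u, A u -> exists v s,
    r <= s /\ \forall u' \near u, A u' -> good_descent a e u' (v - u') s) ->
  exists z : X -> X, [/\ {within A, continuous z},
    equivariant_on actX actX A z & forall u, A u -> good_descent a e u (z u) r].
Proof.
move=> cA iA r0 PA locA.
apply: (equivariant_selection cG aX aX (C := fun u z => good_descent a e u z r)
  (banach_seq_complete (Y := X)) cA iA).
- move=> u Au; split.
    move=> y z t t01 [y1 y2 y3] [z1 z2 z3]; have /andP[t0 t1] := t01.
    have E (c : R) : t * c + (1 - t) * c = c by rewrite -mulrDl subrKC mul1r.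
    split.
    + rewrite (le_trans (ler_normD _ _))// !normrZ (ger0_norm t0) ger0_norm ?subr_ge0//.
      by rewrite -[leRHS]E lerD// ler_wpM2l// subr_ge0.
    + by rewrite -[X in descent _ _ _ _ X]E; apply: descent_convex => //; exact: PA.
    + move=> au; rewrite -[X in descent _ _ _ _ X]E.
      by apply: descent_convex => //; [exact: PA|exact: y3|exact: z3].
  have E2 : (fun z => good_descent a e u z r) =
      Num.norm @^-1` [set s | s <= r] `&` ([set z | descent Phi Psi u z 1] `&`
      \bigcap_(_ in [set x : unit | (a%:E <= I u)%E])
        [set z | descent Phi Psi u z (- (2 * e * r))]).
    apply/seteqP; split => [z [z1 z2 z3]|z [z1 [z2 z3]]].
      by split => //; split => // _ /= au; exact: z3.
    by split => // au; exact: (z3 tt au).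
  rewrite [X in closed X]E2; apply: closedI.
    apply: preimage_closed; last exact: closed_le.
    by move=> z _; exact: norm_continuous.
  apply: closedI; first by apply: descent_closed => //; exact: PA.
  by apply: closed_bigI => _ _; apply: descent_closed => //; exact: PA.
- move=> g u z Au [z1 z2 z3].
  have [L LE] := linear_packed (act_linear aX g).
  have D b : descent Phi Psi u z b -> descent Phi Psi (actX g u) (actX g z) b.
    rewrite /descent (invariant_differential cPhi aX iPhi).
    have -> : actX g u + actX g z = actX g (u + z) by rewrite LE linearD.
    by rewrite !iPsi.
  split; [by rewrite isoX|exact: D|].
  by rewrite functional_invariant => /z3; exact: D.
- move=> u Au; have [v [s [rs H]]] := locA u Au.
  exists (fun u' => (r / s) *: (v - u')); split.
    move=> x; apply: cvgZ; first exact: cvg_cst.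
    by apply: cvgB; [exact: cvg_cst|exact: cvg_id].
  apply: filterS H => u' H Au'; apply: good_descent_scale => //; first exact: PA.
  exact: H.
Qed.

(** Move by a small multiple s of the equivariant field. Convexity of Psi
gives the proportion s of the descent, and Phi differs from its linearisation
by at most e s r uniformly on A: at height at least a the gain is 2 e s r - e
s r. Points below a rise by a multiple of s and stay below M - e s r when s is
small compared with M - a. *)
Lemma equivariant_deformation (A : set X) (M a e : R) :
  compact A -> invariant_set actX A -> (forall u, A u -> (I u <= M%:E)%E) ->
  a < M -> 0 < e ->
  (forall u, A u -> (a%:E <= I u)%E -> exists v,
     (('d Phi u (v - u)%R)%:E + Psi v - Psi u < (- (4 * e * `|v - u|))%:E)%E) ->
  exists (h : X -> X) (r : R), [/\ 0 < r, {within A, continuous h},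
    equivariant_on actX actX A h, forall u, A u -> `|h u - u| <= r &
    forall u, A u -> (I (h u) <= (M - e * r)%:E)%E].
Proof.
move=> cA iA AM aM e0 Hu.
have PA u : A u -> (Psi u < +oo)%E.
  by move=> /AM; rewrite /I /functional; case: (Psi u) (Psi_gtNy u) => [p| |]//.
have [r r0 Hr] := good_descent_uniform cA e0 PA Hu.
have [z [cz ez Hz]] := equivariant_descent_field cA iA r0 PA Hr.
have [d d0 Hd] := compact_uniformly_differentiable cPhi cA e0.
(* The bounds on s serve, in order: convexity, the linearisation of Phi within
   distance d, and the points below height a. *)
pose s := Num.min 1 (Num.min (d / (2 * r)) ((M - a) / (1 + 2 * e * r))).
have er : 0 < e * r by rewrite mulr_gt0.
have q0 : 0 < 1 + 2 * e * r by lra.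
have s0 : 0 < s.
  by rewrite /s !lt_min ltr01 !divr_gt0 ?mulr_gt0 ?subr_gt0.
have s1 : s <= 1 by rewrite /s ge_min lexx.
have sd : s * r < d.
  have : s <= d / (2 * r) by rewrite /s !ge_min lexx !orbT.
  by rewrite ler_pdivlMr ?mulr_gt0// mulrCA; have := mulr_gt0 s0 r0; lra.
have sM : s * (1 + 2 * e * r) <= M - a.
  have : s <= (M - a) / (1 + 2 * e * r) by rewrite /s !ge_min lexx !orbT.
  by rewrite ler_pdivlMr.
have s01 : 0 <= s <= 1 by rewrite ltW.
exists (fun u => u + s *: z u), (s * r); split.
- by rewrite mulr_gt0.
- apply/subspace_continuousP => u Au; apply: cvgD.
    apply: cvg_within.
  apply: cvgZ; first exact: cvg_cst.
  by move/subspace_continuousP : cz; apply.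
- move=> g u Au; have [L LE] := linear_packed (act_linear aX g).
  by rewrite ez// LE linearD linearZ.
- move=> u Au; rewrite addrAC subrr add0r normrZ gtr0_norm// ler_pM2l//.
  by have [] := Hz u Au.
- move=> u Au; have [z1 z2 z3] := Hz u Au.
  have [p Ep] := Psi_finP Psi_gtNy (PA u Au).
  have szd : `|s *: z u| <= s * r by rewrite normrZ gtr0_norm// ler_pM2l.
  have := Hd u (s *: z u) Au (le_lt_trans szd sd).
  move=> /(le_trans (ler_norm _)) hPhi.
  have {}hPhi : Phi (u + s *: z u) <= Phi u + 'd Phi u (s *: z u) + e * (s * r).
    by have := ler_wpM2l (ltW e0) szd; lra.
  have K b : descent Phi Psi u (z u) b ->
      (I (u + s *: z u)%R <= I u + (s * b + e * (s * r))%:E)%E.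
    move=> /(descent_scale Psi_gtNy convPsi (PA u Au) s01)/(descentP Psi_gtNy Ep).
    move=> [q Eq Hq]; rewrite /I /functional Eq Ep -!EFinD lee_fin; lra.
  have [au|ua] := leP a%:E (I u).
    apply: le_trans (K _ (z3 au)) _.
    have := AM u Au; rewrite /I /functional Ep -!EFinD !lee_fin.
    have -> : s * - (2 * e * r) = - (2 * (e * (s * r))) by ring.
    by have := mulr_gt0 e0 (mulr_gt0 s0 r0); lra.
  apply: le_trans (K _ z2) _; move: ua.
  rewrite /I /functional Ep -!EFinD lte_fin lee_fin.
  by move: sM; rewrite mulrDr; have := mulr_gt0 e0 (mulr_gt0 s0 r0); lra.
Qed.

End Deformation.

(** * Palais-Smale sequences and critical levels *)

Section PalaisSmale.
Context {R : realType} {X : normedModType R} (Phi : X -> R) (Psi : X -> \bar R).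
Hypothesis cPhi : continuously_differentiable Phi.
Hypothesis Psi_gtNy : forall u, (-oo < Psi u)%E.
Hypothesis lscPsi : lower_semicontinuous Psi.

Lemma palais_smale_subseq (c : R) (u : nat -> X) (s : nat -> nat) :
  {homo s : m n / (m < n)%N} ->
  palais_smale_sequence Phi Psi c u -> palais_smale_sequence Phi Psi c (u \o s).
Proof.
move=> hs [Iu [eps [e0 ec He]]]; split.
  exact: (cvg_comp _ _ (cvg_subseq hs) Iu).
exists (eps \o s); split => [n|| n v]; [exact: e0| |exact: He].
exact: (cvg_comp _ _ (cvg_subseq hs) ec).
Qed.

(** Testing the inequality with v = l gives the upper bound for the limit of
Psi (u n) which complements lower semicontinuity; so Psi (u n) tends to Psi l,
and all the inequalities pass to the limit. *)
Lemma palais_smale_limit (c : R) (u : nat -> X) (l : X) :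
  palais_smale_sequence Phi Psi c u -> u n @[n --> \oo] --> l ->
  critical_point Phi Psi l /\ functional Phi Psi l = c%:E.
Proof.
move=> [Iu [eps [e0 ec He]]] ul.
have /choice[p Ep] : forall n, exists p, Psi (u n) = p%:E.
  move=> n; move: (Psi_gtNy (u n)) (He n (u n)).
  case: (Psi (u n)) => [q| |]// _; by exists q.
have cP : Phi (u n) @[n --> \oo] --> Phi l.
  apply: continuous_cvg ul; apply: differentiable_continuous; exact: cPhi.1.
have cI : Phi (u n) + p n @[n --> \oo] --> c.
  have E : (fun n => functional Phi Psi (u n)) = (fun n => (Phi (u n) + p n)%:E).
    by apply/funext => n; rewrite /functional Ep.
  by rewrite E in Iu; have /fine_cvgP[_] := Iu.
have cp : p n @[n --> \oo] --> c - Phi l.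
  have -> : p = (fun n => Phi (u n) + p n - Phi (u n)).
    by apply/funext => n; rewrite addrAC subrr add0r.
  exact: cvgB.
have key v w : Psi v = w%:E -> 0 <= 'd Phi l (v - l) + w - (c - Phi l).
  move=> Ew; pose f n := - (eps n * `|v - u n|).
  have vu : v - u n @[n --> \oo] --> v - l by apply: cvgB => //; exact: cvg_cst.
  have fc : f n @[n --> \oo] --> (0 : R).
    rewrite -oppr0 -(mul0r `|v - l|); apply: cvgN; apply: cvgM => //.
    exact: cvg_norm.
  have gc : 'd Phi (u n) (v - u n) + w - p n @[n --> \oo] -->
      'd Phi l (v - l) + w - (c - Phi l).
    apply: cvgB => //; apply: cvgD; last exact: cvg_cst.
    exact: cvg_differential.
  apply: (ler_cvg_to fc gc); apply: nearW => n.
  by have := He n v; rewrite Ew Ep -!EFinD lee_fin.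
have lp : (Psi l <= (c - Phi l)%:E)%E.
  rewrite leNgt; apply/negP => lt1.
  have [a a1 a2] := lte_real_between lt1.
  have [W nW HW] := lscPsi a2.
  have : a <= c - Phi l.
    have ca : (fun=> a) n @[n --> \oo] --> a by exact: cvg_cst.
    apply: (ler_cvg_to ca cp); have H : \forall n \near \oo, W (u n) by exact: ul.
    by apply: filterS H => n /HW; rewrite Ep lte_fin => /ltW.
  by rewrite leNgt a1.
have [q Eq] : exists q, Psi l = q%:E.
  by apply: Psi_finP => //; apply: le_lt_trans lp _; rewrite ltry.
have Eqc : q = c - Phi l.
  apply/eqP; rewrite eq_le; apply/andP; split; first by move: lp; rewrite Eq lee_fin.
  by have := key _ _ Eq; rewrite subrr linear0 add0r subr_ge0.
have Il : functional Phi Psi l = c%:E.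
  by rewrite /functional Eq -EFinD Eqc addrC subrK.
split=> //; split; first by rewrite Il ltry.
move=> v; rewrite Eq; case Ew : (Psi v) (Psi_gtNy v) => [w| |]// _.
  by rewrite -EFinD lee_fin Eqc; exact: key.
by rewrite addey// addye// leey.
Qed.

Hypothesis PS : palais_smale_condition Phi Psi.

(** Critical points satisfy the Palais-Smale inequality with any slope. *)
Lemma critical_palais_smale (c : R) (u : nat -> X) :
  (forall n, critical_point Phi Psi (u n) /\ functional Phi Psi (u n) = c%:E) ->
  palais_smale_sequence Phi Psi c u.
Proof.
move=> Hu; split.
  by under eq_fun do rewrite (Hu _).2; exact: cvg_cst.
exists (fun n => n.+1%:R^-1); split => //.
  exact: cvg_harmonic.
move=> n v; apply: le_trans ((Hu n).1.2 v).
by rewrite lee_fin oppr_le0 mulr_ge0.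
Qed.

Lemma critical_level_compact (c : R) :
  compact [set u | critical_point Phi Psi u /\ functional Phi Psi u = c%:E].
Proof.
apply: sequentially_compact => u Hu.
have psu := critical_palais_smale Hu.
have [s [l [hs sl]]] := PS psu; exists s, l; split => //.
exact: palais_smale_limit (palais_smale_subseq hs psu) sl.
Qed.

Lemma critical_level_invariant {G : topologicalGroupType} (act : G -> X -> X) (c : R) :
  is_action act -> is_isometric act -> invariant_fun act Phi -> invariant_fun act Psi ->
  invariant_set act [set u | critical_point Phi Psi u /\ functional Phi Psi u = c%:E].
Proof.
move=> aX isoX iPhi iPsi; apply/(invariant_setP aX) => g u [[Iu Hu] Ec].
have E : functional Phi Psi (act g u) = functional Phi Psi u.
  by rewrite /functional iPhi iPsi.
split; last by rewrite E.
split; first by rewrite E.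
move=> v; have := Hu (act g^-1%g v).
rewrite -(invariant_differential cPhi aX iPhi g) !iPsi.
have [L LE] := linear_packed (act_linear aX g).
suff -> : act g (act g^-1%g v - u) = v - act g u by [].
by rewrite {1}LE linearB -LE -(actM aX) mulgV (act1 aX).
Qed.

End PalaisSmale.

(** * The classes Gamma_j *)

Section Gamma.
Context {R : realType} {G : topologicalGroupType} {X V : normedModType R}.
Context (actX : G -> X -> X) (actV : G -> V -> V).
Hypothesis cG : compact [set: G].
Hypothesis aX : is_action actX.
Hypothesis aV : is_action actV.
Hypothesis cV : seq_complete V.

Lemma hausdorff_dist_lt (A B : set X) (d : R) : A !=set0 -> compact B ->
  hausdorff_dist A B < d -> forall y, B y -> exists2 x, A x & `|x - y| < d.
Proof.
move=> [x0 Ax0] cB; rewrite /hausdorff_dist gt_max => /andP[_ ltd] y By.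
have lb z : has_inf [set `|z - x| | x in A].
  split; first by exists `|z - x0|, x0.
  by exists 0 => _ [x _ <-].
have [M [_ HM]] := compact_bounded cB.
have le_d : dist_to y A <= sup [set dist_to z A | z in B].
  apply: sup_upper_bound; last by exists y.
  split; first by exists (dist_to y A), y.
  exists (M + 1 + `|x0|) => _ [z Bz <-]; apply: (@le_trans _ _ `|z - x0|).
    by apply: ge_inf; [exact: (lb z).2|exists x0].
  rewrite (le_trans (ler_normB _ _))// lerD2r.
  by apply: HM => //; rewrite ltrDl.
have e0 : 0 < d - dist_to y A by rewrite subr_gt0; exact: le_lt_trans ltd.
have [_ [x Ax <-]] := inf_adherent e0 (lb y).
rewrite -/(dist_to y A) subrKC => yx; exists x => //; by rewrite distrC.
Qed.

Lemma hausdorff_dist_refl (A : set X) : A !=set0 -> hausdorff_dist A A = 0.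
Proof.
move=> [x0 Ax0]; have dA x : A x -> dist_to x A = 0.
  move=> Ax; have lb : has_lbound [set `|x - y| | y in A] by exists 0 => _ [y _ <-].
  apply/eqP; rewrite eq_le; apply/andP; split.
    by apply: (ge_inf lb); exists x => //; rewrite subrr normr0.
  apply: lb_le_inf; first by exists `|x - x|, x.
  by move=> _ [y _ <-].
have E : [set dist_to x A | x in A] = [set 0].
  apply/seteqP; split => [_ [x Ax <-]|_ ->]; first exact: dA.
  by exists x0 => //; exact: dA.
by rewrite /hausdorff_dist E sup1 maxxx.
Qed.

(** A is a limit of sets of index at least j, and the index of sets close to A
does not exceed that of A. *)
Lemma Gamma_index_ge (A : set X) (j : nat) :
  Gamma actX actV j A -> ~ A 0 -> index_ge actX actV A j.
Proof.
move=> [[A0 cA iA] HA] nA0 k kA.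
have [d d0 Hd] := admits_map_neighborhood cG aX aV cV cA iA kA.
have [B [[B0 cB iB] _ jB AB]] := HA d d0.
apply: (gindex_geP actX actV j B0).1 => //; apply: Hd => //.
exact: hausdorff_dist_lt.
Qed.

Lemma index_ge_Gamma (A : set X) (j : nat) :
  D_G actX A -> ~ A 0 -> index_ge actX actV A j -> Gamma actX actV j A.
Proof.
move=> DA nA0 jA; have [A0 _ _] := DA; split=> // e e0; exists A; split => //.
  exact/gindex_geP.
by rewrite hausdorff_dist_refl.
Qed.

Lemma minimax_homo (J : X -> \bar R) :
  {homo minimax actX actV J : i j / (i <= j)%N >-> (i <= j)%E}.
Proof.
move=> i j ij; apply: ereal_inf_le_tmp => _ [A [DA HA] <-]; exists A => //; split => //.
move=> e /HA[B [DB nB jB AB]]; exists B; split => //.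
by apply: le_trans jB; rewrite lee_fin ler_nat.
Qed.

End Gamma.

(** * Almost critical points near almost optimal sets *)

Lemma image_invariant (R : realType) (G : topologicalGroupType)
    (X : normedModType R) (act : G -> X -> X) (A : set X) (h : X -> X) :
  is_action act -> invariant_set act A -> equivariant_on act act A h ->
  invariant_set act (h @` A).
Proof.
move=> aX /(invariant_setP aX) iA eh; apply/(invariant_setP aX).
by move=> g _ [x Ax <-]; rewrite -eh//; exists (act g x) => //; exact: iA.
Qed.

(** Only the values on A matter; off A the limit is 0. *)
Lemma uniform_cauchy_limit (R : realType) (X : completeNormedModType R)
    (A : set X) (u : nat -> X -> X) (r : nat -> R) :
  (forall n k x, A x -> `|u n x - u (n + k)%N x| <= r n) ->
  r n @[n --> \oo] --> (0 : R) ->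
  exists2 h : X -> X, (forall x, A x -> u n x @[n --> \oo] --> h x) &
    (forall n x, A x -> `|u n x - h x| <= r n).
Proof.
move=> Hu r0.
have /choice[h Hh] : forall x, exists l : X, A x -> u n x @[n --> \oo] --> l.
  move=> x; have [Ax|nAx] := pselect (A x); last by exists 0 => /nAx.
  suff [l ul] : exists l : X, u n x @[n --> \oo] --> l by exists l.
  apply: banach_seq_complete => e e0.
  have /cvgrPdist_le/(_ _ e0)[n _ Hn] := r0.
  exists n => m nm; rewrite distrC -(subnKC nm) (le_trans (Hu _ _ _ Ax))//.
  have := Hn n (leqnn n); rewrite /= sub0r normrN.
  exact: le_trans (ler_norm _).
exists h => // n x Ax; rewrite distrC; apply: (cvg_norm_le (Hh x Ax)).
by exists n => // k /= nk; rewrite distrC -(subnKC nk); exact: Hu.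
Qed.

Lemma uniform_limit_continuous (R : realType) (X : normedModType R)
    (A : set X) (u : nat -> X -> X) (h : X -> X) (r : nat -> R) :
  (forall n, {within A, continuous (u n)}) ->
  (forall n x, A x -> `|u n x - h x| <= r n) ->
  r n @[n --> \oo] --> (0 : R) -> {within A, continuous h}.
Proof.
move=> cu uh r0; apply/subspace_continuousP => x Ax; apply/cvgrPdist_lt => e e0.
have e4 : 0 < e / 4 by rewrite divr_gt0.
have /cvgrPdist_lt/(_ _ e4)[n _ /(_ n (leqnn n))] := r0.
rewrite /= sub0r normrN => /(le_lt_trans (ler_norm _)) rn.
have /subspace_continuousP/(_ x Ax)/cvgrPdist_lt/(_ _ e4) := cu n.
rewrite /within /= => K; apply: (@filterS _ (nbhs x) _ _ _ _ K) => y H Ay.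
have h1 := uh n x Ax; have h2 := uh n y Ay; rewrite distrC in h1.
rewrite -(subrKA (u n x)) (le_lt_trans (ler_normD _ _))//.
rewrite -(subrKA (u n y) (u n x)).
have := ler_normD (u n x - u n y) (u n y - h y).
by have := H Ay; move: h1 h2 rn; lra.
Qed.

Lemma lower_semicontinuous_cvg_le (R : realType) (X : topologicalType)
    (f : X -> \bar R) (u : nat -> X) (l : X) (b : R) :
  lower_semicontinuous f -> u n @[n --> \oo] --> l ->
  (\forall n \near \oo, (f (u n) <= b%:E)%E) -> (f l <= b%:E)%E.
Proof.
move=> lf ul fb; rewrite leNgt; apply/negP => /lf[W nW HW].
have H : \forall n \near \oo, W (u n) by exact: ul.
have [n [Wn]] := filter_ex (filterI H fb).
by rewrite leNgt HW.
Qed.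

Section AlmostCritical.
Context {R : realType} {G : topologicalGroupType} {X : completeNormedModType R}.
Context {V : normedModType R} (actX : G -> X -> X) (actV : G -> V -> V).
Context (Phi : X -> R) (Psi : X -> \bar R).
Hypothesis cG : compact [set: G].
Hypothesis aX : is_action actX.
Hypothesis isoX : is_isometric actX.
Hypothesis cPhi : continuously_differentiable Phi.
Hypothesis Psi_gtNy : forall u, (-oo < Psi u)%E.
Hypothesis convPsi : ereal_convex Psi.
Hypothesis lscPsi : lower_semicontinuous Psi.
Hypothesis iPhi : invariant_fun actX Phi.
Hypothesis iPsi : invariant_fun actX Psi.
Let I := functional Phi Psi.
Hypothesis I0 : I 0 = 0%E.

Lemma functional_lsc : lower_semicontinuous I.
Proof.
move=> x a; rewrite /I /functional => aI.
have lt1 : ((a - Phi x)%:E < Psi x)%E by rewrite EFinB lteBlDl.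
have [b b1 b2] := lte_real_between lt1.
have [W nW HW] := lscPsi b2.
have l0 : 0 < b - (a - Phi x) by rewrite subr_gt0.
have cP : {for x, continuous Phi} by apply: differentiable_continuous; exact: cPhi.1.
have /cvgrPdist_lt/(_ _ l0) H := cP.
exists (W `&` [set y | `|Phi x - Phi y| < b - (a - Phi x)]).
  exact: filterI.
move=> y [/HW Wy] /= /(le_lt_trans (ler_norm _)) h.
case: (Psi y) Wy => [q| |]//; last by move=> _; rewrite addey// ltry.
by rewrite -EFinD !lte_fin => Wy; lra.
Qed.

(** Ekeland's principle for equivariant maps h from A to X, starting from the
identity. The images h(A) lie in Gamma_j because they have index at least j
and, being at negative height, avoid 0; this is why c_j bounds sup I over h(A)
below. At the almost minimal map the set h(A) contains an almost critical
point, as otherwise composing h with an equivariant deformation would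
contradict minimality. *)
Lemma minimax_almost_critical (j : nat) (A : set X) (c e : R) :
  D_G actX A -> index_ge actX actV A j -> minimax actX actV I j = c%:E ->
  0 < e -> c + e * e < 0 -> (forall u, A u -> (I u <= (c + e * e)%:E)%E) ->
  exists u x, [/\ A x, `|u - x| <= e, ((c - e)%:E <= I u <= (c + e * e)%:E)%E &
    forall v, ((- (4 * e * `|v - u|))%:E <=
      ('d Phi u (v - u)%R)%:E + Psi v - Psi u)%E].
Proof.
move=> DA jA Ec e0 ce AM; have [[x0 Ax0] cA iA] := DA.
have IM0 (B : set X) b : b < 0 -> (forall u, B u -> (I u <= b%:E)%E) -> ~ B 0.
  by move=> b0 HB /HB; rewrite I0 lee_fin leNgt b0.
(* The constraint on the height keeps the images away from 0 and is inherited
   by limits. *)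
pose D := [set h : X -> X | [/\ {within A, continuous h},
  equivariant_on actX actX A h & forall x, A x -> (I (h x) <= (c + e * e)%:E)%E]].
pose S (h : X -> X) := ereal_sup [set I u | u in h @` A].
have DDG h : D h -> D_G actX (h @` A).
  move=> [ch eh Ih]; split; first by exists (h x0), x0.
    exact: continuous_compact.
  exact: image_invariant.
have DS h : D h -> exists2 f, S h = f%:E & c <= f <= c + e * e.
  move=> Dh; have [ch eh Ih] := Dh.
  have S1 : (S h <= (c + e * e)%:E)%E.
    by apply: ge_ereal_sup => _ [_ [x Ax <-] <-]; exact: Ih.
  have S2 : (c%:E <= S h)%E.
    rewrite -Ec; apply: ge_ereal_inf; exists (S h) => //; exists (h @` A) => //.
    apply: index_ge_Gamma; first exact: DDG.
      by apply: IM0 ce _ => _ [x Ax <-]; exact: Ih.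
    exact: index_ge_image.
  case: (S h) S1 S2 => [f| |]//.
  by rewrite !lee_fin => h1 h2; exists f => //; rewrite h1 h2.
pose F h := fine (S h).
have FS h : D h -> S h = (F h)%:E by move=> /DS[f Sf _]; rewrite /F Sf.
have Fge h : D h -> c <= F h <= c + e * e.
  by move=> /DS[f Sf]; rewrite /F Sf.
have FI h x : D h -> A x -> (I (h x) <= (F h)%:E)%E.
  by move=> Dh Ax; rewrite -FS//; apply: ereal_sup_ubound; exists (h x) => //; exists x.
have Fle h b : D h -> (forall x, A x -> (I (h x) <= b%:E)%E) -> F h <= b.
  move=> Dh Hb; rewrite -lee_fin -FS//.
  by apply: ge_ereal_sup => _ [_ [x Ax <-] <-]; exact: Hb.
have Did : D id.
  split=> //; apply/subspace_continuousP => x Ax; exact: cvg_within.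
have [|||||h [Dh Fh dh Hh]] := @ekeland_principle R _ D
  (fun h h' r => forall x, A x -> `|h x - h' x| <= r) F c e id _ _ _ _ _ e0 Did.
- by move=> h _ x _; rewrite subrr normr0.
- move=> h1 h2 h3 r s H1 H2 x Ax; rewrite -(subrKA (h2 x)).
  by rewrite (le_trans (ler_normD _ _))// lerD ?H1 ?H2.
- by move=> h1 h2 r s rs H x Ax; exact: le_trans (H x Ax) rs.
- by move=> h /Fge /andP[].
- move=> u r Du ur r0 Fu.
  have [h uh rh] := uniform_cauchy_limit (A := A) ur r0.
  have nF m n : (m <= n)%N -> F (u n) <= F (u m).
    by apply/nonincreasing_seqP: m n.
  have Ih n x : A x -> (I (h x) <= (F (u n))%:E)%E.
    move=> Ax; apply: (lower_semicontinuous_cvg_le functional_lsc (uh x Ax)).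
    exists n => // m /= nm; apply: le_trans (FI _ _ (Du m) Ax) _.
    by rewrite lee_fin; exact: nF.
  have Dh : D h.
    split.
    + by apply: uniform_limit_continuous rh r0 => n; have [] := Du n.
    + move=> g x Ax; have /(invariant_setP aX)/(_ g x Ax) Agx := iA.
      apply: (cvg_unique _ (uh _ Agx)); first exact: norm_hausdorff.
      have -> : (fun n => u n (actX g x)) = (fun n => actX g (u n x)).
        by apply/funext => n; have [_ /(_ g x Ax) -> _] := Du n.
      by apply: continuous_cvg (uh x Ax); exact: action_continuous.
    + move=> x Ax; apply: le_trans (Ih 0%N x Ax) _.
      by rewrite lee_fin; have /andP[] := Fge _ (Du 0%N).
  exists h => // n; split; first by move=> x Ax; exact: rh.
  by apply: Fle => // x Ax; exact: Ih.
apply: contrapT => H.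
have /andP[Fh1 Fh2] := Fge _ Dh.
have [_ cB iB] := DDG _ Dh.
have IB u : (h @` A) u -> (I u <= (F h)%:E)%E by move=> [x Ax <-]; exact: FI.
have aF : c - e < F h by rewrite (lt_le_trans _ Fh1)// ltrBlDr ltrDl.
have dhe x : A x -> `|x - h x| <= e.
  move=> Ax; apply: le_trans (dh x Ax) _; rewrite ler_pdivrMr//.
  by have /andP[_] := Fge _ Did; lra.
have slope u : (h @` A) u -> ((c - e)%:E <= I u)%E -> exists v,
    (('d Phi u (v - u)%R)%:E + Psi v - Psi u < (- (4 * e * `|v - u|))%:E)%E.
  move=> [x Ax <-] hx; apply: contrapT => Hv; apply: H; exists (h x), x; split => //.
  - by rewrite distrC; exact: dhe.
  - rewrite hx /=; apply: le_trans (FI _ _ Dh Ax) _.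
    by rewrite lee_fin.
  - by move=> v; rewrite leNgt; apply/negP => Hv'; apply: Hv; exists v.
have [k [r [r0 ck ek kr kI]]] := equivariant_deformation cG aX isoX cPhi Psi_gtNy
  convPsi lscPsi iPhi iPsi cB iB IB aF e0 slope.
have [ch eh _] := Dh; have [_ _ iA'] := DA.
have er : 0 < e * r by rewrite mulr_gt0.
have Dk : D (k \o h).
  split; first exact: (within_continuous_image_comp ch ck).
    by move=> g x Ax /=; rewrite eh// ek//; exists x.
  move=> x Ax /=; have /kI : (h @` A) (h x) by exists x.
  move=> /le_trans; apply; rewrite lee_fin; lra.
have hk x : A x -> `|h x - (k \o h) x| <= r.
  by move=> Ax; rewrite distrC /=; apply: kr; exists x.
have := Hh _ _ r0 Dk hk; apply/negP; rewrite -leNgt; apply: Fle => // x Ax.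
by apply: kI; exists x.
Qed.

End AlmostCritical.

(** * The minimax values *)

Section Main.
Context {R : realType} {G : topologicalGroupType} {X : completeNormedModType R}.
Context {V : normedModType R} (actX : G -> X -> X) (actV : G -> V -> V).
Context (Phi : X -> R) (Psi : X -> \bar R).
Hypothesis cG : compact [set: G].
Hypothesis aX : is_action actX.
Hypothesis isoX : is_isometric actX.
Hypothesis aV : is_action actV.
Hypothesis cV : seq_complete V.
Hypothesis cPhi : continuously_differentiable Phi.
Hypothesis Psi_gtNy : forall u, (-oo < Psi u)%E.
Hypothesis convPsi : ereal_convex Psi.
Hypothesis lscPsi : lower_semicontinuous Psi.
Hypothesis iPhi : invariant_fun actX Phi.
Hypothesis iPsi : invariant_fun actX Psi.
Let I := functional Phi Psi.
Hypothesis I0 : I 0 = 0%E.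
Hypothesis PS : palais_smale_condition Phi Psi.
Let mm := minimax actX actV I.

Lemma almost_critical_cvg (c : R) (e : nat -> R) (u : nat -> X) :
  (forall n, 0 < e n) -> e n @[n --> \oo] --> (0 : R) ->
  (forall n, ((c - 2 * e n)%:E <= I (u n) <= (c + 2 * e n)%:E)%E) ->
  (forall n v, ((- (4 * e n * `|v - u n|))%:E <=
      ('d Phi (u n) (v - u n)%R)%:E + Psi v - Psi (u n))%E) ->
  exists (s : nat -> nat) (l : X), [/\ {homo s : m n / (m < n)%N},
    u (s n) @[n --> \oo] --> l, critical_point Phi Psi l & I l = c%:E].
Proof.
move=> e0 ec Iu Hu.
have psu : palais_smale_sequence Phi Psi c u.
  split; last first.
    exists (fun n => 4 * e n); split => //; first by move=> n; rewrite mulr_gt0.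
    by rewrite -(mulr0 4); apply: cvgMr.
  have e2 : 2 * e n @[n --> \oo] --> (0 : R) by rewrite -(mulr0 2); apply: cvgMr.
  have EFc (f : nat -> R) : f n @[n --> \oo] --> c ->
      (f n)%:E @[n --> \oo] --> c%:E.
    by move=> fc; apply: cvg_EFin => //; exact: nearW.
  have h1 : (c - 2 * e n)%:E @[n --> \oo] --> c%:E.
    apply: EFc; rewrite -[X in _ --> X](subr0 c).
    by apply: cvgB e2; exact: cvg_cst.
  have h2 : (c + 2 * e n)%:E @[n --> \oo] --> c%:E.
    apply: EFc; rewrite -[X in _ --> X](addr0 c).
    by apply: cvgD e2; exact: cvg_cst.
  by apply: (squeeze_cvge _ h1 h2); apply: nearW => n; exact: Iu.
have [s [l [hs sl]]] := PS psu; exists s, l.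
have [cl Il] := palais_smale_limit cPhi Psi_gtNy lscPsi
  (palais_smale_subseq hs psu) sl.
by split.
Qed.

(** Bounded by 1, so that its squares are bounded by its terms, and by m, so
that c + e^2 stays negative when m <= - c / 2. *)
Definition small_seq (m : R) (n : nat) : R :=
  Num.min n.+1%:R^-1 (Num.min 1 m).

Lemma small_seq_gt0 (m : R) n : 0 < m -> 0 < small_seq m n.
Proof. by move=> m0; rewrite /small_seq !lt_min invr_gt0 ltr0n ltr01 m0. Qed.

Lemma small_seq_le (m : R) n : small_seq m n <= m.
Proof. by rewrite /small_seq !ge_min lexx !orbT. Qed.

Lemma small_seq_sqr (m : R) n : 0 < m -> small_seq m n * small_seq m n <= small_seq m n.
Proof.
move=> m0; rewrite ler_piMr//; first by rewrite ltW// small_seq_gt0.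
by rewrite /small_seq !ge_min lexx !orbT.
Qed.

Lemma small_seq_cvg (m : R) : 0 < m -> small_seq m n @[n --> \oo] --> (0 : R).
Proof.
move=> m0; have h1 : (fun=> 0) n @[n --> \oo] --> (0 : R) by exact: cvg_cst.
apply: (squeeze_cvgr _ h1 (cvg_harmonic (R := R))); apply: nearW => n.
by rewrite ltW ?small_seq_gt0//= /small_seq ge_min lexx.
Qed.

Lemma neg_sublevel_notin0 (A : set X) (b : R) : b < 0 ->
  (forall u, A u -> (I u <= b%:E)%E) -> ~ A 0.
Proof. by move=> b0 HA /HA; rewrite I0 lee_fin leNgt b0. Qed.

(** Sets of Gamma_j at negative height do not contain 0, so they have index at
least j. *)
Lemma minimax_approx (j : nat) (b : R) : b < 0 -> (mm j < b%:E)%E ->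
  exists A, [/\ D_G actX A, index_ge actX actV A j &
    forall u, A u -> (I u <= b%:E)%E].
Proof.
move=> b0 /ereal_inf_ltP[_ [A GA <-] Ab]; exists A.
have AI u : A u -> (I u <= b%:E)%E.
  by move=> Au; apply: le_trans (ltW Ab); apply: ereal_sup_ubound; exists u.
split => //; first by case: GA.
apply: (Gamma_index_ge cG aX aV cV GA); exact: neg_sublevel_notin0 AI.
Qed.

Lemma minimax_critical_value (j : nat) :
  (-oo < mm j)%E -> (mm j < 0)%E -> critical_value Phi Psi (mm j).
Proof.
case E : (mm j) => [c| |]// _; rewrite lte_fin => c0.
have m0 : 0 < - c / 2 by rewrite divr_gt0// oppr_gt0.
pose e := small_seq (- c / 2).
have e0 n : 0 < e n by exact: small_seq_gt0.
have ce n : c + e n * e n < 0.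
  by have := small_seq_sqr n m0; have := small_seq_le (- c / 2) n; rewrite -/(e n); lra.
have /choice[u Hu] : forall n, exists u,
    ((c - e n)%:E <= I u <= (c + e n * e n)%:E)%E /\
    forall v, ((- (4 * e n * `|v - u|))%:E <=
      ('d Phi u (v - u)%R)%:E + Psi v - Psi u)%E.
  move=> n; have [|A [DA jA AI]] := @minimax_approx j (c + e n * e n) (ce n).
    by rewrite E lte_fin ltrDl mulr_gt0.
  have [u [x [_ _ ? ?]]] := minimax_almost_critical cG aX isoX cPhi Psi_gtNy
    convPsi lscPsi iPhi iPsi I0 DA jA E (e0 n) (ce n) AI.
  by exists u.
have [||s [l [_ _ cl Il]]] := almost_critical_cvg (c := c) (u := u) e0 (small_seq_cvg m0).
- move=> n; have [/andP[h1 h2] _] := Hu n; apply/andP; split.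
    by apply: le_trans h1; rewrite lee_fin; have := e0 n; lra.
  apply: le_trans h2 _; rewrite lee_fin.
  by have := small_seq_sqr n m0; rewrite -/(e n); have := e0 n; lra.
- by move=> n; exact: (Hu n).2.
by exists l.
Qed.

(** Compactness of K makes the distance to K attained. *)
Lemma thickening_closed (K : set X) (r : R) : compact K ->
  closed [set y | exists2 x, K x & `|x - y| <= r].
Proof.
move=> /compact_near_coveringP cK; rewrite -[X in closed X]setCK.
apply: open_closedC; rewrite openE => y /= Hy.
have Hlt x : K x -> r < `|x - y|.
  by move=> Kx; rewrite ltNge; apply/negP => xy; apply: Hy; exists x.
have H : \forall y' \near y, K `<=` (fun x => r < `|x - y'|).
  apply: (cK _ (nbhs y) (fun y' x => r < `|x - y'|)).
  move=> x Kx; have d0 : 0 < (`|x - y| - r) / 2 by rewrite divr_gt0// subr_gt0 Hlt.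
  exists (ball_ Num.norm x ((`|x - y| - r) / 2), ball_ Num.norm y ((`|x - y| - r) / 2)).
    by split; apply/nbhs_normP; eexists; try exact: d0.
  move=> [x' y'] /= [xx' yy']; rewrite ltNge; apply/negP => h.
  have := ler_normD (x - x') (x' - y'); have := ler_normD (x - y') (y' - y).
  rewrite !subrKA (distrC y' y); move: xx' yy'; rewrite /ball_ /=; lra.
rewrite /interior /=; apply: filterS H => y' Hy' [x Kx]; apply/negP; rewrite -ltNge.
exact: Hy'.
Qed.

(** The critical set at level c is compact and invariant, and avoids 0 because
I(0) = 0, so its index is finite; the index extends to a neighbourhood. When
the critical set is empty, p = 0 works, as only the empty set is close to it.
*)
Lemma critical_level_tube (c : R) : c < 0 ->
  (forall A, Sigma_class actX A -> compact A -> (gindex actX actV A < +oo)%E) ->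
  exists p (d : R), 0 < d /\ forall B, compact B -> invariant_set actX B ->
    (forall y, B y -> exists2 x, critical_point Phi Psi x /\ I x = c%:E & `|x - y| < d) ->
    admits_map actX actV B p.
Proof.
move=> c0 Hg; pose K := [set x | critical_point Phi Psi x /\ I x = c%:E].
have cK : compact K by exact: critical_level_compact.
have iK : invariant_set actX K by exact: critical_level_invariant.
have [[x0 Kx0]|nK] := pselect (K !=set0); last first.
  exists 0%N, 1; split => // B cB iB BK; exists (fun _ _ => 0).
  split; [by case|by case|].
  by move=> y /BK[x Kx _]; case: nK; exists x.
have [|p Kp] := gindex_lty (ex_intro _ x0 Kx0) (Hg K _ cK).
  split => //; last by apply: compact_closed => //; exact: norm_hausdorff.
  by move=> [_]; rewrite I0 => -[]; apply/eqP; rewrite gt_eqF.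
have [d d0 Hd] := admits_map_neighborhood cG aX aV cV cK iK Kp.
by exists p, d.
Qed.

(** A is the union of what remains and of a part close to K, which admits a
map into V^p; subadditivity gives the bound. Both parts are closed, and the
thresholds d / 2 overlap, so that they cover A. *)
Lemma index_ge_remove (A K : set X) (j p : nat) (d : R) :
  0 < d -> compact A -> invariant_set actX A -> compact K -> invariant_set actX K ->
  (forall B, compact B -> invariant_set actX B ->
    (forall y, B y -> exists2 x, K x & `|x - y| < d) -> admits_map actX actV B p) ->
  index_ge actX actV A (j + p) ->
  let B := A `&` [set y | forall x, K x -> d / 2 <= `|x - y|] in
  [/\ compact B, invariant_set actX B & index_ge actX actV B j].
Proof.
move=> d0 cA iA cK iK Hp jA B.
have iAP := (invariant_setP aX A).1 iA; have iKP := (invariant_setP aX K).1 iK.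
have dist g x y : `|actX (g^-1)%g x - y| = `|x - actX g y|.
  by rewrite -[LHS](isoX g) (actB aX) -(actM aX) mulgV (act1 aX).
have cB : compact B.
  apply: compact_closedI => //.
  have -> : [set y | forall x, K x -> d / 2 <= `|x - y|] =
      \bigcap_(x in K) (fun y => `|x - y|) @^-1` [set r | d / 2 <= r] by [].
  apply: closed_bigI => x _; apply: preimage_closed; last exact: closed_ge.
  by move=> y _; apply: cvg_norm; apply: cvgB; [exact: cvg_cst|exact: cvg_id].
have iB : invariant_set actX B.
  apply/(invariant_setP aX) => g y [Ay Hy]; split; first exact: iAP.
  by move=> x Kx; rewrite -dist; apply: Hy; exact: iKP.
split => // k kB.
pose C := A `&` [set y | exists2 x, K x & `|x - y| <= d / 2].
have cC : compact C by apply: compact_closedI => //; exact: thickening_closed.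
have iC : invariant_set actX C.
  apply/(invariant_setP aX) => g y [Ay [x Kx xy]]; split; first exact: iAP.
  exists (actX g x); first exact: iKP.
  by rewrite -(actB aX) isoX.
have pC : admits_map actX actV C p.
  apply: Hp => // y [_ [x Kx xy]]; exists x => //.
  by rewrite (le_lt_trans xy)// ltr_pdivrMr// ltr_pMr// ltr1n.
have ABC : A = B `|` C.
  apply/seteqP; split => [y Ay|y [[]|[]]//].
  have [H|H] := pselect (exists2 x, K x & `|x - y| <= d / 2); first by right.
  left; split => // x Kx; rewrite leNgt; apply/negP => xy; apply: H.
  by exists x => //; exact: ltW.
have := jA (k + p)%N; rewrite {1}ABC => /(_ _); rewrite leq_add2r; apply.
exact: admits_map_union.
Qed.

(** If the limit c of the increasing sequence c_j were negative, the critical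
set at level c would have a neighbourhood of finite index p. Removing it from
an almost optimal set for c_(j+p) leaves an almost optimal set for c_j, since
both values are close to c; the almost critical points obtained there stay
away from the critical set at level c, while a subsequence of them converges
to a point of it. *)
Lemma minimax_cvg0 :
  (forall A, Sigma_class actX A -> compact A -> (gindex actX actV A < +oo)%E) ->
  (forall j, (-oo < mm j)%E) -> (forall j, (mm j < 0)%E) ->
  mm j @[j --> \oo] --> 0%E.
Proof.
move=> Hg mN m0.
have hm : {homo mm : i j / (i <= j)%N >-> (i <= j)%E} by exact: minimax_homo.
have := ereal_nondecreasing_cvgn hm.
set s := ereal_sup _ => ms.
have sub j : (mm j <= s)%E by apply: ereal_sup_ubound; exists j.
have s0 : (s <= 0)%E by apply: ge_ereal_sup => _ [j _ <-]; exact: ltW.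
move: s0; rewrite le_eqVlt => /predU1P[<-//|].
have := sub 0%N; case Es : s => [c| |]//; last first.
  by rewrite leeNy_eq => /eqP E; have := mN 0%N; rewrite E.
move=> _; rewrite lte_fin => c0; exfalso.
have [p [d [d0 Hp]]] := critical_level_tube c0 Hg.
pose K := [set x | critical_point Phi Psi x /\ I x = c%:E].
have cK : compact K by exact: critical_level_compact.
have iK : invariant_set actX K by exact: critical_level_invariant.
(* Points within d / 4 of a set at distance d / 2 from K stay at distance d /
   4 from K. *)
pose m := Num.min (- c / 2) (d / 4).
have m0' : 0 < m by rewrite /m lt_min !divr_gt0// oppr_gt0.
have mc : m <= - c / 2 by rewrite /m ge_min lexx.
have md : m <= d / 4 by rewrite /m ge_min lexx orbT.
pose e := small_seq m.
have e0 n : 0 < e n by exact: small_seq_gt0.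
have e2 n : 0 < e n * e n by rewrite mulr_gt0.
have em n : e n <= m by exact: small_seq_le.
have esq n : e n * e n <= e n by exact: small_seq_sqr.
have /choice[u Hu] : forall n, exists u,
    [/\ ((c - 2 * e n)%:E <= I u <= (c + 2 * e n)%:E)%E,
      forall v, ((- (4 * e n * `|v - u|))%:E <=
        ('d Phi u (v - u)%R)%:E + Psi v - Psi u)%E &
      forall x, K x -> d / 4 <= `|x - u|].
  move=> n.
  (* j must be positive for the set remaining after the removal to be
     nonempty. *)
  have [j j0 [cj Ej /andP[cj1 cj2]]] : exists2 j, (0 < j)%N & exists2 cj, mm j = cj%:E &
      c - e n * e n < cj <= c.
    have : ((c - e n * e n)%:E < s)%E by rewrite Es lte_fin ltrBlDr ltrDl.
    move=> /ereal_sup_gtP[_ [j _ <-] hj].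
    exists j.+1 => //; have := sub j.+1; have := lt_le_trans hj (hm _ _ (leqnSn j)).
    rewrite Es; case: (mm j.+1) => [cj| |]//.
    by rewrite lte_fin lee_fin => h1 h2; exists cj => //; rewrite h1 h2.
  have cje : cj + e n * e n < 0 by have := esq n; have := em n; lra.
  have [|A [[A0 cA iA] jA AI]] := @minimax_approx (j + p) (cj + e n * e n) cje.
    by apply: le_lt_trans (sub _) _; rewrite Es lte_fin; lra.
  have [cB iB jB] := index_ge_remove d0 cA iA cK iK Hp jA.
  set B := _ `&` _ in cB iB jB.
  have DB : D_G actX B.
    split => //; apply: contrapT => B0.
    have : admits_map actX actV B 0.
      by exists (fun _ _ => 0); split; [by case|by case|] => y By; case: B0; exists y.
    by move=> /jB; rewrite leqNgt j0.
  have BI v : B v -> (I v <= (cj + e n * e n)%:E)%E by move=> [Av _]; exact: AI.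
  have [v [x [[Ax Kx] vx /andP[I1 I2] Hv]]] := minimax_almost_critical cG aX isoX
    cPhi Psi_gtNy convPsi lscPsi iPhi iPsi I0 DB jB Ej (e0 n) cje BI.
  exists v; split => //.
    apply/andP; split.
      by apply: le_trans I1; rewrite lee_fin; have := esq n; lra.
    by apply: le_trans I2 _; rewrite lee_fin; have := esq n; have := e0 n; lra.
  move=> k /Kx kx; have := ler_normD (k - v) (v - x); rewrite subrKA.
  by have := em n; lra.
have [||t [l [_ tl cl Il]]] := almost_critical_cvg (c := c) (u := u) e0 (small_seq_cvg m0').
- by move=> n; have [] := Hu n.
- by move=> n; have [] := Hu n.
have d4 : 0 < d / 4 by rewrite divr_gt0.
have /cvgrPdist_lt/(_ _ d4)[n _ /(_ n (leqnn n))] := tl.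
by have [_ _ /(_ l (conj cl Il))] := Hu (t n); rewrite leNgt => /negP.
Qed.

End Main.

Unset Implicit Arguments.

Theorem theorem3p8 (R : realType) (X : completeNormedModType R)
    (V : normedModType R) (G : topologicalGroupType)
    (actX : G -> X -> X) (actV : G -> V -> V) (Xj : nat -> set X)
    (Phi : X -> R) (Psi : X -> \bar R) :
  condition_G0 actX actV Xj ->
  continuously_differentiable Phi ->
  (forall u, (-oo < Psi u)%E) ->
  ereal_convex Psi ->
  lower_semicontinuous Psi ->
  (exists u, (Psi u < +oo)%E) ->
  palais_smale_condition Phi Psi ->
  invariant_fun actX Phi ->
  invariant_fun actX Psi ->
  functional Phi Psi 0 = 0%E ->
  (forall A, Sigma_class actX A -> compact A ->
     (gindex actX actV A < +oo)%E) ->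
  (forall j : nat, (-oo < minimax actX actV (functional Phi Psi) j)%E) ->
  (forall j : nat, exists A,
     [/\ A !=set0, compact A, Sigma_class actX A,
         (j%:R%:E <= gindex actX actV A)%E
       & (ereal_sup [set functional Phi Psi u | u in A] < 0)%E]) ->
  (forall j : nat,
     (minimax actX actV (functional Phi Psi) j < 0)%E /\
     critical_value Phi Psi (minimax actX actV (functional Phi Psi) j)) /\
  minimax actX actV (functional Phi Psi) j @[j --> \oo] --> 0%E.
Proof.
move=> [cG aX isoX _ _ _ _ fV aV _ _] cPhi Psi_gtNy convPsi lscPsi _ PS iPhi iPsi
  I0 Hg mN Hneg.
have cV := finite_dimensional_complete fV.
have m0 j : (minimax actX actV (functional Phi Psi) j < 0)%E.
  have [A [A0 cA [nA0 iA _] jA supA]] := Hneg j.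
  apply: le_lt_trans supA; apply: ge_ereal_inf; eexists; last exact: lexx.
  exists A => //; apply: index_ge_Gamma => //.
  exact/(gindex_geP actX actV j A0).
split; last exact: minimax_cvg0.
by move=> j; split; [exact: m0|exact: minimax_critical_value].
Qed.
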